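(* Let $n$ be a fixed positive integer. There is a deterministic algorithm which, given a positive integer $H$, computes the number $S_n(H)$ of $n\times n$ stochastic matrices all of whose entries are rational numbers of height at most $H$, and whose complexity is $H^{3n/2-1+o(1)}$ as $H\to\infty$.
   Context: A stochastic matrix is a square matrix $A=(\alpha_{i,j})_{i,j=1}^n$ with nonnegative entries such that $\sum_{j=1}^n\alpha_{i,j}=1$ for each $i=1,\ldots,n$. The height of a rational number $\alpha$ is $\mathrm{h}(\alpha)=\max\{|s|,r\}$, where $\alpha=s/r$ with integers $r\ge 1$ and $s$, $\gcd(r,s)=1$. Thus $S_n(H)$ counts stochastic matrices with entries in $\mathcal{F}(H)=\{\alpha\in\mathbb{Q} : \alpha\ge 0,\ \mathrm{h}(\alpha)\le H\}$. Complexity means the number of elementary (bit) operations performed by the algorithm; $o(1)$ denotes a quantity tending to $0$ as $H\to\infty$ for fixed $n$. *)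

(* Defs.v *)
From mathcomp Require Import all_boot all_order all_algebra.
From mathcomp Require Import finmap all_classical all_reals all_analysis.
Set Implicit Arguments.
Unset Strict Implicit.
Unset Printing Implicit Defensive.
Import Order.TTheory GRing.Theory Num.Theory.

Definition height (a : rat) : nat := maxn `|numq a|%N `|denq a|%N.

Definition stochastic (R : numDomainType) (n : nat) (A : 'M[R]_n) : Prop :=
  (forall i j, (0 <= A i j)%R) /\ (forall i, (\sum_j A i j)%R = 1%R).

Definition stochastic_set (n H : nat) : set 'M[rat]_n :=
  [set A | stochastic A /\ forall i j, height (A i j) <= H]%classic.
Arguments stochastic_set : clear implicits.

(* [fset_set] is only meaningful on finite sets. *)
Lemma finite_stochastic_set n H : finite_set (stochastic_set n H).
Proof.
pose E := ('I_H.+1 * 'I_H.+1)%type.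
pose f (M : 'M[E]_n) : 'M[rat]_n :=
  map_mx (fun e : E => ((e.1 : nat)%:R / (e.2 : nat)%:R)%R) M.
apply: (@sub_finite_set _ _ (f @` [set: 'M[E]_n])%classic); last first.
  exact/finite_image/finite_finset.
move=> A [[A0 _] AH].
exists (\matrix_(i, j) (inord `|numq (A i j)|%N, inord `|denq (A i j)|%N))%R => //.
apply/matrixP => i j; rewrite !mxE /=.
have := AH i j; rewrite /height geq_max => /andP[hn hd].
rewrite !inordK // -[RHS]divq_num_den !natr_absz ger0_norm ?numq_ge0 // ger0_norm ?denq_ge0 //.
Qed.

Definition num_stochastic (n H : nat) : nat := #|` fset_set (stochastic_set n H)|%fset.

(* Random access machine with logarithmic cost (Cook and Reckhow; Aho, Hopcroft
   and Ullman).  Every register holds a natural number; a program is finite. *)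
Definition memory := nat -> nat.

Definition set_reg (m : memory) (i v : nat) : memory :=
  fun j => if j == i then v else m j.

Inductive instr : Type :=
| IConst of nat & nat        (* r_i := c *)
| IAdd of nat & nat & nat    (* r_i := r_j + r_k *)
| ISub of nat & nat & nat    (* r_i := max (r_j - r_k, 0) *)
| IMul of nat & nat & nat    (* r_i := r_j * r_k *)
| IDiv of nat & nat & nat    (* r_i := floor (r_j / r_k), and 0 if r_k = 0 *)
| ILoad of nat & nat         (* r_i := r_(r_j) *)
| IStore of nat & nat        (* r_(r_i) := r_j *)
| IJump of nat               (* goto l *)
| IJzero of nat & nat.       (* if r_i = 0 goto l *)

Definition program := seq instr.

Definition exec_mem (c : instr) (m : memory) : memory :=
  match c with
  | IConst i v => set_reg m i v
  | IAdd i j k => set_reg m i (m j + m k)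
  | ISub i j k => set_reg m i (m j - m k)
  | IMul i j k => set_reg m i (m j * m k)
  | IDiv i j k => set_reg m i (m j %/ m k)
  | ILoad i j => set_reg m i (m (m j))
  | IStore i j => set_reg m (m i) (m j)
  | IJump _ | IJzero _ _ => m
  end.

Definition next_pc (c : instr) (pc : nat) (m : memory) : nat :=
  match c with
  | IJump l => l
  | IJzero i l => if m i == 0 then l else pc.+1
  | _ => pc.+1
  end.

Definition bitlen (x : nat) : nat := (trunc_log 2 x).+1.

(* Number of bit operations charged for one instruction: linear in the length of
   the operands (addresses included for indirect access), except that [IMul] and
   [IDiv] are charged the cost of the schoolbook algorithms. *)
Definition bit_cost (c : instr) (m : memory) : nat :=
  match c with
  | IConst _ v => bitlen v
  | IAdd _ j k | ISub _ j k => bitlen (m j) + bitlen (m k)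
  | IMul _ j k | IDiv _ j k => bitlen (m j) * bitlen (m k)
  | ILoad _ j => bitlen (m j) + bitlen (m (m j))
  | IStore i j => bitlen (m i) + bitlen (m j)
  | IJump _ => 1
  | IJzero i _ => bitlen (m i)
  end.

(* [runs p pc m m' t]: started at instruction [pc] with memory [m], the program
   [p] halts with memory [m'] after [t] bit operations.  It halts when the
   program counter leaves [p]. *)
Inductive runs (p : program) : nat -> memory -> memory -> nat -> Prop :=
| runs_halt pc m : size p <= pc -> runs p pc m m 0
| runs_step pc m m' t : pc < size p ->
    let c := nth (IJump 0) p pc in
    runs p (next_pc c pc m) (exec_mem c m) m' t ->
    runs p pc m m' (bit_cost c m + t).

Definition input (x : nat) : memory := set_reg (fun=> 0) 0 x.

(* Input and output are in register 0; all other registers start at 0. *)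
Definition computes_in (p : program) (x y t : nat) : Prop :=
  exists2 m : memory, runs p 0 (input x) m t & m 0 = y.

(* Main.v *)
Require Import Defs.
From mathcomp Require Import all_boot all_order all_algebra.
From mathcomp Require Import finmap all_classical all_reals all_analysis.
From mathcomp Require Import zify ring lra.
Set Implicit Arguments.
Unset Strict Implicit.
Unset Printing Implicit Defensive.
Import Order.TTheory GRing.Theory Num.Theory numFieldNormedType.Exports.

(** A row of a stochastic matrix with entries of height at most H is an n-tuple
of fractions s/r in lowest terms, 0 <= s <= r <= H, whose sum is 1, and the rows
are independent of each other.  So the number wanted is R ^ n, where R is the
number of such tuples ([num_stochasticE]), and R has to be found in time
H^(3n/2 - 1 + o(1)).

Any number can be the address of a register, so the memory of the machine is a
dictionary.  Let k and l be the halves of n, rounded down and up.  The machine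
runs through all k-tuples of fractions and records how often each sum occurs;
then it runs through all l-tuples and looks up, for each of them, the number of
k-tuples with the complementary sum ([meet_in_the_middle]).  A sum a/d with
d <= D is filed under the floor of a D^2 / d.  This number depends only on the
value of a/d, and two distinct values differ by at least 1/D^2, so they get
different numbers ([key_inj]): no fraction is ever put in lowest terms.  The time is
H^(2l + o(1)), and 2l <= 3n/2 - 1 holds for every n > 1 except 3.

For n = 3 the pairs of denominators are pruned.  Let r1 = g u and r2 = g v with
g their gcd.  If s1/r1 + s2/r2 + s3/r3 = 1, then u and v are coprime divisors of
r3, so that u v <= H ([compatible_of_sum1]).  Then
(g u v)^2 = (r1 r2) (u v) <= H^3, and there are only H^(3/2 + o(1)) triples with
g u v <= H^(3/2), because sums of reciprocals are logarithmic
([count_compatible]).  Each surviving pair of denominators has at most (H + 1)^2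
pairs of numerators, which gives H^(7/2 + o(1)).

For n = 1 the answer is 1.  Since the exponent of the running time is prescribed
and not only bounded above, the program also counts up to the square root of
H^(3n-2) ([exec_pad]).  Altogether H^(3n-2) <= T^2 <= C L^8 H^(3n-2) for the
running time T, where L is the bit length of H ([run_num_stochastic]); as L is
logarithmic in H, the exponent of T tends to 3n/2 - 1 ([exponent_cvg]).

The program is written with expressions, assignments, stores and while loops,
which are compiled to machine instructions.  Costs are found from the text of
the program alone: if every stored number has at most w bits, then the numbers
met while evaluating an expression have O(w) bits, and the evaluation costs
O(w^2) ([straight_expr_cost]).  So it is enough to bound the numbers held
between two commands and to count iterations. *)

(** * Sums over words and positional digits *)

Definition digit b k x := (x %/ b ^ k) %% b.

(** The code q stands for the fraction (q %% B) / (q %/ B); the fractions of a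
list are added without reducing, as the machine does. *)
Fixpoint sum_den B qs := if qs is q :: qs' then q %/ B * sum_den B qs' else 1.
Fixpoint sum_num B qs :=
  if qs is q :: qs' then q %% B * sum_den B qs' + sum_num B qs' * (q %/ B) else 0.

Lemma sum_mul m n (G : nat -> nat) :
  \sum_(x < m * n) G x = \sum_(i < n) \sum_(j < m) G (j + m * i).
Proof.
elim: n => [|n IH]; first by rewrite muln0 !big_ord0.
rewrite big_ord_recr /= -IH mulnS addnC big_split_ord /=; congr (_ + _).
by apply: eq_bigr => j _; rewrite addnC.
Qed.

(** The sum of F over all words of length k in the letters 0, ..., b - 1, in a
form that splits at any position. *)
Fixpoint word_sum b k (F : seq nat -> nat) : nat :=
  if k is k'.+1 then \sum_(d < b) word_sum b k' (fun s => F ((d : nat) :: s)) else F [::].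

Lemma eq_word_sum b k F G :
  (forall s, size s = k -> all (fun d => d < b) s -> F s = G s) ->
  word_sum b k F = word_sum b k G.
Proof.
elim: k F G => [|k IH] F G FG /=; first exact: FG.
apply: eq_bigr => d _; apply: IH => s sk sb; apply: FG => /=; first by rewrite sk.
by rewrite ltn_ord.
Qed.

Lemma word_sum_cat b k l F :
  word_sum b (k + l) F = word_sum b k (fun s => word_sum b l (fun s' => F (s ++ s'))).
Proof.
elim: k F => [|k IH] F //=; apply: eq_bigr => d _; exact: IH.
Qed.

Lemma word_sumZ b k c F : word_sum b k (fun s => c * F s) = c * word_sum b k F.
Proof.
elim: k F => [|k IH] F //=; rewrite big_distrr; apply: eq_bigr => d _; exact: IH.
Qed.

Lemma leq_word_sum b k F m : (forall s, F s <= m) -> word_sum b k F <= b ^ k * m.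
Proof.
elim: k F => [|k IH] F Fm /=; first by rewrite mul1n.
rewrite -[leqRHS](_ : \sum_(d < b) b ^ k * m = _); last first.
  by rewrite sum_nat_const card_ord expnS mulnA.
by apply: leq_sum => d _; apply: IH.
Qed.

Lemma digit0 b x y : x < b -> digit b 0 (x + b * y) = x.
Proof. by move=> xb; rewrite /digit expn0 divn1 addnC mulnC modnMDl modn_small. Qed.

Lemma digitS b i x y : x < b -> digit b i.+1 (x + b * y) = digit b i y.
Proof.
move=> xb; have b0 : 0 < b by apply: leq_trans xb.
by rewrite /digit expnS divnMA (addnC x) (mulnC b y) divnMDl// (divn_small xb) addn0.
Qed.

Definition digits b k x := [seq digit b i x | i <- iota 0 k].

Lemma digitsS b k x y : x < b -> digits b k.+1 (x + b * y) = x :: digits b k y.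
Proof.
move=> xb; rewrite /digits /= digit0//; congr (_ :: _).
by rewrite (iotaDl 1 0) -map_comp; apply: eq_map => i /=; rewrite digitS.
Qed.

(** A loop over the numbers below b ^ k visits every word once: the digits of the
counter are the letters. *)
Lemma word_sum_digits b k F : \sum_(x < b ^ k) F (digits b k x) = word_sum b k F.
Proof.
elim: k F => [|k IH] F; first by rewrite expn0 big_ord_recl big_ord0 addn0.
rewrite expnS (sum_mul _ _ (fun x => F (digits b k.+1 x))) exchange_big /=.
apply: eq_bigr => d _; rewrite -IH; apply: eq_bigr => x _.
by rewrite digitsS.
Qed.

(** Numerators and denominators come from two counters, so that a loop over the
denominators can skip the loop over the numerators. *)
Definition pair_digits B l y z := [seq digit B i y * B + digit B i z | i <- iota 0 l].

Lemma pair_digitsS B l y y' z z' : y < B -> z < B ->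
  pair_digits B l.+1 (y + B * y') (z + B * z') = (y * B + z) :: pair_digits B l y' z'.
Proof.
move=> yB zB; rewrite /pair_digits /= !digit0//; congr (_ :: _).
by rewrite (iotaDl 1 0) -map_comp; apply: eq_map => i /=; rewrite !digitS.
Qed.

Lemma word_sum_pair_digits B l F :
  \sum_(y < B ^ l) \sum_(z < B ^ l) F (pair_digits B l y z) = word_sum (B * B) l F.
Proof.
elim: l F => [|l IH] F; first by rewrite expn0 !big_ord_recl !big_ord0 !addn0.
rewrite expnS (sum_mul _ _ (fun y => \sum_(z < _) F (pair_digits B l.+1 y z))) /=.
rewrite (sum_mul _ _ (fun q => word_sum _ _ (fun s => F (q :: s)))) /=.
under eq_bigr => y' _ do under eq_bigr => y _ do
  rewrite (sum_mul _ _ (fun z => F (pair_digits B l.+1 (y + B * y') z))) /= exchange_big /=.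
rewrite exchange_big /=; apply: eq_bigr => y _; rewrite exchange_big /=.
apply: eq_bigr => z _; rewrite -IH; apply: eq_bigr => y' _; apply: eq_bigr => z' _.
by rewrite pair_digitsS// addnC mulnC.
Qed.

Lemma word_sum_tuple b k (F : seq nat -> nat) :
  word_sum b k F = \sum_(t : k.-tuple 'I_b) F (map val t).
Proof.
elim: k F => [|k IH] F /=.
  rewrite (big_pred1 [tuple]) => [//|t]; by rewrite [t]tuple0; apply/esym/eqP.
rewrite (reindex (fun p : 'I_b * k.-tuple 'I_b => [tuple of p.1 :: p.2])) /=.
  by rewrite -(pair_bigA _ (fun d (t : k.-tuple 'I_b) => F (val d :: map val t))) /=;
    apply: eq_bigr => d _; rewrite IH.
exists (fun t => (thead t, behead_tuple t)) => [[d t] _|t _] /=.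
  by congr pair; apply: val_inj.
by rewrite [t in RHS]tuple_eta; apply: val_inj.
Qed.

Lemma word_sum_card b k (P : pred (seq nat)) :
  word_sum b k (fun s => P s) = #|[set t : k.-tuple 'I_b | P (map val t)]|.
Proof.
rewrite word_sum_tuple -sum1dep_card.
by rewrite [RHS]big_mkcond; apply: eq_bigr => t _; case: (P _).
Qed.

(** Distinct fractions with denominators at most D differ by at least 1 / D^2, so
that after scaling by D^2 their floors differ; and a floor depends only on the
value of the fraction. *)
Lemma key_inj D n1 d1 n2 d2 : 0 < d1 <= D -> 0 < d2 <= D ->
  (n1 * D ^ 2 %/ d1 == n2 * D ^ 2 %/ d2) = (n1 * d2 == n2 * d1).
Proof.
wlog le12 : n1 d1 n2 d2 / n1 * d2 <= n2 * d1 => [hw|].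
  case: (leqP (n1 * d2) (n2 * d1)) => [/hw//|/ltnW/hw h] h1 h2.
  by rewrite eq_sym h// eq_sym.
move=> /andP[p1 l1] /andP[p2 l2].
case: (eqVneq (n1 * d2) (n2 * d1)) => [e|ne].
  rewrite -(@divnMr d2 (n1 * _) _ p2) -(@divnMr d1 (n2 * _) _ p1).
  by rewrite mulnAC e mulnAC [d2 * d1]mulnC !eqxx.
have lt : n1 * d2 < n2 * d1 by rewrite ltn_neqAle ne.
apply/negbTE; rewrite neq_ltn; apply/orP; left.
rewrite ltn_divLR// -(ltn_pmul2r p2).
have e2 := divn_eq (n2 * D ^ 2) d2; have m2 := ltn_pmod (n2 * D ^ 2) p2.
set k := (n2 * D ^ 2 %/ d2) in e2 *.
(* The scaled fractions differ by at least D^2 / (d1 d2) >= 1. *)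
have : n1 * d2 * D ^ 2 + D ^ 2 <= n2 * D ^ 2 * d1 by nia.
have : d2 * d1 <= D ^ 2 by rewrite -mulnn leq_mul.
nia.
Qed.

(** * Fractions in the unit interval as integer codes *)

(** A fraction in lowest terms has exactly one code, which makes counting codes
the same as counting rationals. *)
Definition reduced_code B q := (q %% B <= q %/ B) && coprime (q %/ B) (q %% B).
Definition code_val B q : rat := ((q %% B)%:R / (q %/ B)%:R)%R.

Lemma reduced_code_gt0 B q : reduced_code B q -> 0 < q %/ B.
Proof.
rewrite /reduced_code; case: (q %/ B) => [|//]; rewrite leqn0 => /andP[/eqP->].
by [].
Qed.

Lemma sum_den_gt0 B qs : all (reduced_code B) qs -> 0 < sum_den B qs.
Proof.
by elim: qs => //= q qs IH /andP[/reduced_code_gt0 q0 /IH d0]; rewrite muln_gt0 q0.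
Qed.

Lemma sum_code_val B qs : all (reduced_code B) qs ->
  (\sum_(q <- qs) code_val B q)%R = ((sum_num B qs)%:R / (sum_den B qs)%:R)%R.
Proof.
elim: qs => [|q qs IH] /=; first by rewrite big_nil mul0r.
case/andP=> /reduced_code_gt0 q0 vqs; have d0 := sum_den_gt0 vqs.
rewrite big_cons IH// /code_val natrD !natrM.
field; by rewrite !pnatr_eq0 -!lt0n q0 d0.
Qed.

Lemma sum_den_le B qs : all (fun q => q < B * B) qs -> sum_den B qs <= B ^ size qs.
Proof.
elim: qs => //= q qs IH /andP[qB /IH dB]; rewrite expnS leq_mul// ltnW//.
by case: B qB {IH dB} => // B qB; rewrite ltn_divLR.
Qed.

Definition key D n d := n * D ^ 2 %/ d.

Lemma key_sum_eq1 B n qs qs' :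
  all (reduced_code B) qs -> all (fun q => q < B * B) qs -> size qs <= n ->
  all (reduced_code B) qs' -> all (fun q => q < B * B) qs' -> size qs' <= n -> 0 < B ->
  (sum_num B qs <= sum_den B qs) &&
    (key (B ^ n) (sum_num B qs') (sum_den B qs') ==
     key (B ^ n) (sum_den B qs - sum_num B qs) (sum_den B qs))
  = ((\sum_(q <- qs ++ qs') code_val B q)%R == 1%R).
Proof.
move=> v l s v' l' s' B0.
have d0 := sum_den_gt0 v; have d0' := sum_den_gt0 v'.
have dn : sum_den B qs <= B ^ n by rewrite (leq_trans (sum_den_le l))// leq_pexp2l.
have dn' : sum_den B qs' <= B ^ n by rewrite (leq_trans (sum_den_le l'))// leq_pexp2l.
rewrite /key key_inj ?d0 ?d0'// big_cat /= !sum_code_val//.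
set x := sum_num B qs; set d := sum_den B qs in d0 dn *.
set x' := sum_num B qs'; set d' := sum_den B qs' in d0' dn' *.
have -> : ((x%:R / d%:R + x'%:R / d'%:R)%R == 1%R :> rat) = (x * d' + x' * d == d * d').
  rewrite -(eqr_nat rat) natrD !natrM.
  have d1 : (d%:R != 0 :> rat)%R by rewrite pnatr_eq0 -lt0n.
  have d1' : (d'%:R != 0 :> rat)%R by rewrite pnatr_eq0 -lt0n.
  rewrite -[RHS](inj_eq (mulIf (invr_neq0 (mulf_neq0 d1 d1')))) mulfV ?mulf_neq0//.
  by congr (_ == _); field; rewrite ?d1 ?d1'.
apply/idP/idP => [/andP[le /eqP e]|/eqP e]; first by apply/eqP; nia.
apply/andP; split; last by apply/eqP; nia.
by nia.
Qed.

(** With g the gcd of r1 = g u and r2 = g v, the inequality says u v <= H.  It is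
necessary for r1 and r2 to be two of three denominators of a sum equal to 1. *)
Definition compatible H r1 r2 := (r1 * r2 != 0) && (r1 * r2 <= H * gcdn r1 r2 ^ 2).

(** Dividing the common factor g out and reading the equation modulo u leaves
s1 v r3 = 0 modulo u, where s1 and v are prime to u. *)
Lemma dvd_of_sum1 u v g s1 s2 s3 r3 :
  coprime u v -> coprime (g * u) s1 ->
  s1 * (g * v) * r3 + s2 * (g * u) * r3 + s3 * (g * u * (g * v)) =
    g * u * (g * v) * r3 -> 0 < g -> u %| r3.
Proof.
move=> uv us e g0; move: us; rewrite coprimeMl => /andP[_ us].
have e2 : s1 * v * r3 + (s2 * r3 + s3 * g * v) * u = g * v * r3 * u.
  by apply/eqP; rewrite -(eqn_pmul2l g0); apply/eqP; lia.
have : u %| s1 * v * r3.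
  by rewrite -(@dvdn_addl ((s2 * r3 + s3 * g * v) * u) u) ?dvdn_mull// e2 dvdn_mull.
by rewrite -mulnA Gauss_dvdr// Gauss_dvdr.
Qed.

(** Both u and v divide r3, and they are coprime, so u v <= r3 <= H. *)
Lemma compatible_of_sum1 r1 r2 r3 s1 s2 s3 H :
  0 < r1 -> 0 < r2 -> 0 < r3 <= H -> coprime r1 s1 -> coprime r2 s2 ->
  s1 * r2 * r3 + s2 * r1 * r3 + s3 * (r1 * r2) = r1 * r2 * r3 -> compatible H r1 r2.
Proof.
move=> r10 r20 /andP[r30 r3H] c1 c2 e.
rewrite /compatible muln_eq0 negb_or -!lt0n r10 r20 /=.
set g := gcdn r1 r2; have g0 : 0 < g by rewrite gcdn_gt0 r10.
have /dvdnP[u e1] := dvdn_gcdl r1 r2; have /dvdnP[v e2] := dvdn_gcdr r1 r2.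
rewrite -/g mulnC in e1; rewrite -/g mulnC in e2.
have uv : coprime u v.
  by rewrite /coprime -(eqn_pmul2l g0) muln_gcdr -e1 -e2 muln1.
move: e c1 c2; rewrite [in X in X -> _]e1 [in X in X -> _]e2 => e.
rewrite e1 e2 => c1 c2.
have du := dvd_of_sum1 uv c1 e g0.
have dv : v %| r3.
  apply: (@dvd_of_sum1 v u g s2 s1 s3 r3) => //; first by rewrite coprime_sym.
  by rewrite -[RHS]mulnAC; move: e; lia.
have : u * v <= H by rewrite (leq_trans _ r3H)// dvdn_leq// Gauss_dvd// du.
rewrite -mulnn => uvH; nia.
Qed.

Lemma compatible_of_sum3 B H q1 q2 q3 : reduced_code B q1 -> reduced_code B q2 ->
  reduced_code B q3 -> q3 %/ B <= H ->
  (\sum_(q <- [:: q1; q2; q3]) code_val B q)%R = 1%R -> compatible H (q1 %/ B) (q2 %/ B).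
Proof.
move=> v1 v2 v3 q3H; have p1 := reduced_code_gt0 v1; have p2 := reduced_code_gt0 v2.
have p3 := reduced_code_gt0 v3.
case/andP: v1 => _ c1; case/andP: v2 => _ c2; rewrite !big_cons big_nil addr0 /code_val => e.
apply: (@compatible_of_sum1 _ _ (q3 %/ B) (q1 %% B) (q2 %% B) (q3 %% B)) => //; first by rewrite p3.
apply/eqP; rewrite -(eqr_nat rat) !natrD !natrM; apply/eqP.
move: e p1 p2 p3; rewrite !lt0n -!(pnatr_eq0 rat).
move: (_%:R)%R (_%:R)%R (_%:R)%R (_%:R)%R (_%:R)%R (_%:R)%R => a b c d f g e b0 d0 g0.
have -> : (g * c * a + d * f * a + b * (f * c) =
    (g / f + (d / c + b / a)) * (f * c * a))%R by field; rewrite ?b0 ?d0 ?g0.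
by rewrite e mul1r.
Qed.

Lemma leq_sum_nat m n (F G : nat -> nat) : (forall i, m <= i < n -> F i <= G i) ->
  \sum_(m <= i < n) F i <= \sum_(m <= i < n) G i.
Proof.
move=> FG; rewrite big_nat_cond [leqRHS]big_nat_cond.
by apply: leq_sum => i /andP[/FG].
Qed.

(** The harmonic sum is logarithmic: each of the bitlen H dyadic blocks
contributes at most K. *)
Lemma sum_div_le K H : \sum_(1 <= i < H.+1) K %/ i <= K * bitlen H.
Proof.
suff bound j : \sum_(1 <= i < 2 ^ j) K %/ i <= K * j.
  apply: leq_trans (bound _).
  have HL : H < 2 ^ bitlen H by exact: trunc_log_ltn.
  by rewrite [leqRHS](big_cat_nat _ (n := H.+1))//= leq_addr.
elim: j => [|j IH]; first by rewrite big_geq.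
rewrite (big_cat_nat _ (n := 2 ^ j)) ?expn_gt0 ?leq_exp2l//= mulnS addnC.
apply: leq_add IH; apply: (@leq_trans (\sum_(2 ^ j <= i < 2 ^ j.+1) K %/ 2 ^ j)).
  by apply: leq_sum_nat => i /andP[ij _]; rewrite leq_div2l// expn_gt0.
rewrite sum_nat_const_nat expnS mul2n -addnn addnK mulnC; exact: leq_trunc_div.
Qed.

(** For fixed g and u there are at most K / (g u) values of v; then two harmonic
sums remain. *)
Lemma count_triples K H :
  \sum_(1 <= g < H.+1) \sum_(1 <= u < H.+1) \sum_(1 <= v < H.+1) (g * u * v <= K)
    <= K * bitlen H ^ 2.
Proof.
rewrite expnS expn1 mulnA.
apply: (@leq_trans (\sum_(1 <= g < H.+1) (K %/ g) * bitlen H)); last first.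
  by rewrite -big_distrl /= leq_mul2r sum_div_le orbT.
apply: leq_sum_nat => g /andP[g0 _].
apply: leq_trans (sum_div_le _ _); apply: leq_sum_nat => u /andP[u0 _].
rewrite -divnMA.
have -> : \sum_(1 <= v < H.+1) (g * u * v <= K) = \sum_(1 <= v < H.+1) (v <= K %/ (g * u)).
  by apply: eq_bigr => v _; rewrite leq_divRL ?muln_gt0 ?g0// mulnC.
move: (K %/ _) => M; elim: H => [|H IH]; first by rewrite big_geq.
rewrite big_nat_recr//=; case: (leqP H.+1 M) => [HM|_]; last by rewrite addn0.
apply: leq_trans HM; rewrite -[X in _ <= X]addn1 leq_add2r.
apply: (@leq_trans (\sum_(1 <= v < H.+1) 1)); first by apply: leq_sum => v _; exact: leq_b1.
by rewrite sum_nat_const_nat muln1 subn1.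
Qed.

Lemma isqrt_ex m : exists K, K ^ 2 <= m < K.+1 ^ 2.
Proof.
elim: m => [|m [K /andP[l r]]]; first by exists 0.
case: (ltnP m.+1 (K.+1 ^ 2)) => h; first by exists K; rewrite h leqW.
exists K.+1; rewrite h /=; have : m.+1 <= K.+1 ^ 2 by [].
by move=> h2; rewrite (leq_ltn_trans h2)// ltn_exp2r.
Qed.

(** The pair (g u, g v) determines g, u and v, and
(g u v)^2 = (g u) (g v) (u v) <= H * H * H. *)
Lemma count_compatible H : (\sum_(r1 < H.+1) \sum_(r2 < H.+1) compatible H r1 r2) ^ 2
  <= H ^ 3 * bitlen H ^ 4.
Proof.
have [K /andP[K1 K2]] := isqrt_ex (H ^ 3).
suff le : \sum_(r1 < H.+1) \sum_(r2 < H.+1) compatible H r1 r2 <= K * bitlen H ^ 2.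
  apply: (@leq_trans ((K * bitlen H ^ 2) ^ 2)); first by rewrite leq_exp2r.
  by rewrite expnMn -expnM leq_mul2r K1 orbT.
apply: leq_trans (count_triples K H).
have KP m : m ^ 2 <= H ^ 3 -> m <= K.
  by move=> h; rewrite -ltnS -(@ltn_exp2r _ _ 2)//; apply: leq_ltn_trans h K2.
apply: (@leq_trans (\sum_(r1 < H.+1) \sum_(r2 < H.+1)
  \sum_(1 <= g < H.+1) \sum_(1 <= u < H.+1) \sum_(1 <= v < H.+1)
    ((r1 == g * u :> nat) && (r2 == g * v :> nat) && (g * u * v <= K)))).
  apply: leq_sum => r1 _; apply: leq_sum => r2 _.
  case: (boolP (compatible _ _ _)) => // /andP[].
  rewrite muln_eq0 negb_or -!lt0n => /andP[r10 r20].
  have g0 : 0 < gcdn r1 r2 by rewrite gcdn_gt0 r10.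
  have /dvdnP[u e1] := dvdn_gcdl r1 r2; have /dvdnP[v e2] := dvdn_gcdr r1 r2.
  set g := gcdn r1 r2 in g0 e1 e2 *; move=> le.
  have u0 : 0 < u by move: r10; rewrite e1 muln_gt0 => /andP[].
  have v0 : 0 < v by move: r20; rewrite e2 muln_gt0 => /andP[].
  have r1H := ltn_ord r1; have r2H := ltn_ord r2.
  have gH : 1 <= g < H.+1 by rewrite g0 (leq_trans _ r1H)// ltnS e1 leq_pmull.
  have uH : 1 <= u < H.+1 by rewrite u0 (leq_trans _ r1H)// ltnS e1 leq_pmulr.
  have vH : 1 <= v < H.+1 by rewrite v0 (leq_trans _ r2H)// ltnS e2 leq_pmulr.
  rewrite (bigD1_seq g) ?mem_index_iota ?iota_uniq//=.
  rewrite (bigD1_seq u) ?mem_index_iota ?iota_uniq//=.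
  rewrite (bigD1_seq v) ?mem_index_iota ?iota_uniq//=.
  rewrite -!addnA; apply: leq_trans (leq_addr _ _).
  rewrite e1 e2 mulnC eqxx mulnC eqxx /=.
  suff -> : g * u * v <= K by [].
  apply: KP.
  have a1 : u * v <= H.
    rewrite -(@leq_pmul2l (g ^ 2)) ?expn_gt0 ?g0//.
    move: le; rewrite {1}e1 {1}e2; lia.
  have a2 : (u * g) * (v * g) <= H * H by rewrite leq_mul// -?e1 -?e2 -ltnS.
  rewrite (_ : (g * u * v) ^ 2 = (u * g) * (v * g) * (u * v)); last by lia.
  by rewrite (_ : H ^ 3 = H * H * H) ?leq_mul//; lia.
rewrite pair_big /= exchange_big /=; apply: leq_sum => g _.
rewrite exchange_big /=; apply: leq_sum => u _.
rewrite exchange_big /=; apply: leq_sum => v _.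
case: (_ <= K); last by rewrite big1 // => p _; rewrite andbF.
case: (pickP (fun p : 'I_H.+1 * 'I_H.+1 => (p.1 == g * u :> nat) && (p.2 == g * v :> nat)))
  => [p /andP[/eqP p1 /eqP p2]|none]; last by rewrite big1 // => p _; rewrite none.
rewrite (bigD1 p)//= big1 ?addn0 => [|q qp]; first by rewrite p1 p2 !eqxx.
apply/eqP; rewrite eqb0 andbT; apply: contra qp => /andP[/eqP q1 /eqP q2].
by apply/eqP; rewrite [q]surjective_pairing [p]surjective_pairing; congr pair;
  apply: val_inj; rewrite /= ?q1 ?q2.
Qed.

(** * Meeting in the middle *)

Definition stochastic_row B s :=
  all (reduced_code B) s && ((\sum_(q <- s) code_val B q)%R == 1%R).

(** The sum of the fractions in qs, and what is missing from it to 1, as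
addresses in the dictionary. *)
Definition tuple_key B n qs := key (B ^ n) (sum_num B qs) (sum_den B qs).
Definition compl_key B n qs := key (B ^ n) (sum_den B qs - sum_num B qs) (sum_den B qs).

Lemma pair_digits_div B l y z : 0 < B -> map (divn^~ B) (pair_digits B l y z) = digits B l y.
Proof.
move=> B0; rewrite -map_comp; apply: eq_map => i /=.
by rewrite divnMDl// divn_small ?addn0// ltn_pmod.
Qed.

(** The triple sum is what the program computes: [fl] is a test that may skip a
tuple of denominators, provided no row is lost, and the inner sum over x is the
entry found in the dictionary. *)
Lemma meet_in_the_middle B n k l (fl : seq nat -> bool) : 0 < B -> k <= n -> l <= n ->
  (forall qs qs', size qs = l -> size qs' = k ->
     all (fun q => q < B * B) (qs ++ qs') -> stochastic_row B (qs ++ qs') ->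
     fl (map (divn^~ B) qs)) ->
  \sum_(y < B ^ l) \sum_(z < fl (digits B l y) * B ^ l)
     all (reduced_code B) (pair_digits B l y z) *
     (sum_num B (pair_digits B l y z) <= sum_den B (pair_digits B l y z)) *
     \sum_(x < (B * B) ^ k)
        (tuple_key B n (digits (B * B) k x) == compl_key B n (pair_digits B l y z)) *
        all (reduced_code B) (digits (B * B) k x)
  = word_sum (B * B) (l + k) (stochastic_row B).
Proof.
move=> B0 kn ln flP.
pose G qs := fl (map (divn^~ B) qs) * (all (reduced_code B) qs * (sum_num B qs <= sum_den B qs) *
  word_sum (B * B) k (fun qs' =>
    (tuple_key B n qs' == compl_key B n qs) * all (reduced_code B) qs')).
transitivity (word_sum (B * B) l G).
  rewrite -word_sum_pair_digits; apply: eq_bigr => y _.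
  rewrite /G; case: (boolP (fl (digits B l y))) => fy.
    rewrite mul1n; apply: eq_bigr => z _.
    by rewrite pair_digits_div// fy mul1n -word_sum_digits.
  rewrite mul0n big_ord0 big1// => z _.
  by rewrite pair_digits_div// (negPf fy).
rewrite word_sum_cat; apply: eq_word_sum => qs sqs lqs; rewrite /G.
rewrite mulnA -word_sumZ; apply: eq_word_sum => qs' sqs' lqs'.
rewrite -[RHS]/(nat_of_bool (stochastic_row B (qs ++ qs'))) /stochastic_row all_cat.
case: (boolP (all _ qs)) => [v|_]; last by rewrite !(mul0n, muln0).
case: (boolP (all (reduced_code B) qs')) => [v'|_]; last by rewrite !(mul0n, muln0).
rewrite mul1n muln1 -[RHS]/(nat_of_bool (_ == _)) -(@key_sum_eq1 B n) ?sqs ?sqs'//.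
case: (boolP (_ && _)) => [e|]; last by rewrite -mulnA mulnb => /negPf->; rewrite muln0.
have -> : fl (map (divn^~ B) qs).
  apply: (flP qs qs') => //; first by rewrite all_cat lqs.
  by rewrite /stochastic_row all_cat v v' -(@key_sum_eq1 B n) ?sqs ?sqs'.
by case/andP: e => e1 e2; rewrite /tuple_key /compl_key e1 e2.
Qed.

(** * Rational stochastic matrices as rows of codes *)

(** The inverse of [code_val] on reduced codes. *)
Definition code_of B (a : rat) := `|denq a| * B + `|numq a|.

Lemma code_valK B q : reduced_code B q -> q < B * B -> code_of B (code_val B q) = q.
Proof.
move=> v qB; have q0 := reduced_code_gt0 v; case/andP: v => _ c.
have B0 : 0 < B by case: B qB {q0 c}.
rewrite /code_of /code_val [RHS](divn_eq q B).
have c' : coprime `|(Posz (q %% B))| `|(Posz (q %/ B))| by rewrite !absz_nat coprime_sym.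
have q0' : ((Posz (q %/ B)) != 0)%R by rewrite eqz_nat -lt0n.
have -> : ((q %% B)%:R / (q %/ B)%:R)%R =
    ((Posz (q %% B))%:~R / (Posz (q %/ B))%:~R)%R :> rat by rewrite !pmulrn.
rewrite coprimeq_num// coprimeq_den//.

rewrite (negPf q0') gtr0_sg ?ltz_nat// mul1r !absz_nat.
by [].
Qed.

Lemma code_val_ge0 B q : (0 <= code_val B q)%R.
Proof. by rewrite /code_val divr_ge0// ler0n. Qed.

Lemma height_code_val B q H : reduced_code B q -> q %/ B <= H -> height (code_val B q) <= H.
Proof.
move=> v qH; have q0 := reduced_code_gt0 v; case/andP: v => sr c.
have q0' : (Posz (q %/ B) != 0)%R by rewrite eqz_nat -lt0n.
have c' : coprime `|Posz (q %% B)| `|Posz (q %/ B)| by rewrite !absz_nat coprime_sym.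
rewrite /height /code_val !pmulrn coprimeq_num// coprimeq_den//.
rewrite (negPf q0') gtr0_sg ?ltz_nat// mul1r geq_max !absz_nat (leq_trans sr)//.
Qed.

Lemma code_ofK B a : (0 <= a <= 1)%R -> height a < B ->
  [/\ reduced_code B (code_of B a), code_val B (code_of B a) = a & code_of B a < B * B].
Proof.
move=> /andP[a0 a1] hB.
have dE : Posz `|denq a| = denq a by rewrite gez0_abs ?denq_ge0.
have nE : Posz `|numq a| = numq a by rewrite gez0_abs ?numq_ge0.
have nd : `|numq a| <= `|denq a|.
  rewrite -lez_nat dE nE -(ler_int rat) -[leRHS]mul1r -ler_pdivrMr ?ltr0z ?denq_gt0//.
  by rewrite divq_num_den.
move: hB; rewrite /height gtn_max => /andP[nB dB].
have divE : code_of B a %/ B = `|denq a|.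
  by rewrite /code_of divnMDl ?(leq_ltn_trans _ nB)// divn_small ?addn0.
have modE : code_of B a %% B = `|numq a| by rewrite /code_of modnMDl modn_small.
split.
- by rewrite /reduced_code divE modE nd coprime_sym coprime_num_den.
- rewrite /code_val divE modE -[RHS]divq_num_den !pmulrn.
  by rewrite -[in X in (X / _)%R = _]/(Posz `|numq a|) nE dE.
- have : `|denq a|.+1 * B <= B * B by rewrite leq_mul2r dB orbT.
  by rewrite mulSn /code_of; apply: leq_trans; rewrite addnC ltn_add2r.
Qed.

Definition code_matrix B n (M : {ffun 'I_n -> n.-tuple 'I_(B * B)}) : 'M[rat]_n :=
  (\matrix_(i, j) code_val B (tnth (M i) j))%R.

(** Entries of a stochastic matrix lie between 0 and 1, where the height is the
denominator; so a matrix is a choice, for each row independently, of a tuple of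
reduced codes with sum 1. *)
Lemma num_stochasticE n H :
  num_stochastic n H = #|[set t : n.-tuple 'I_(H.+1 * H.+1) | stochastic_row H.+1 (map val t)]| ^ n.
Proof.
set B := H.+1; set R := [set t | _].
pose S := [set M : {ffun 'I_n -> n.-tuple 'I_(B * B)} | M \in ffun_on (mem R)].
have rowP (t : n.-tuple 'I_(B * B)) : t \in R ->
    (forall j, reduced_code B (tnth t j)) /\ (\sum_j code_val B (tnth t j))%R = 1%R.
  rewrite inE /stochastic_row => /andP[/allP cop /eqP sum1]; split=> [j|].
    by apply: cop; apply: map_f; apply: mem_tnth.
  by rewrite -[RHS]sum1 big_map big_tuple.
have Sin M i : M \in S -> M i \in R by rewrite inE => /ffun_onP /(_ i).
have inj : {in S &, injective (@code_matrix B n)}.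
  move=> M M' MS MS' /matrixP E; apply/ffunP => i; apply: eq_from_tnth => j.
  have [c _] := rowP _ (Sin _ i MS); have [c' _] := rowP _ (Sin _ i MS').
  have := E i j; rewrite !mxE => /(congr1 (code_of B)).
  by rewrite !code_valK//; apply: val_inj.
have -> : num_stochastic n H = #|S|.
  rewrite /num_stochastic (_ : fset_set _ = [fset code_matrix M | M in S]%fset); last first.
    apply/fsetP => A; rewrite in_fset_set; last exact: finite_stochastic_set.
    apply/idP/imfsetP => /= [|[M MS ->]].
      rewrite inE /= => -[[A0 A1] Ah].
      have A01 i j : (0 <= A i j <= 1)%R.
        rewrite A0 /= -(A1 i) (bigD1 j)//= lerDl sumr_ge0// => k _; exact: A0.
      have AE i j : [/\ reduced_code B (code_of B (A i j)),
          code_val B (code_of B (A i j)) = A i j & code_of B (A i j) < B * B].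
        by apply: code_ofK; rewrite ?ltnS.
      have AB i j : code_of B (A i j) < B * B by case: (AE i j).
      exists [ffun i => [tuple Ordinal (AB i j) | j < n]].
        rewrite inE; apply/ffun_onP => i; rewrite ffunE inE /stochastic_row; apply/andP; split.
          by apply/allP => _ /mapP[_ /mapP[j _ ->] ->]; case: (AE i j).
        rewrite big_map big_map -(A1 i) big_enum; apply/eqP; apply: eq_bigr => j _ /=.
        by case: (AE i j).
      apply/matrixP => i j; rewrite mxE ffunE tnth_mktuple /=; by case: (AE i j).
    rewrite inE /=; split; first split=> [i j|i]; rewrite ?mxE ?code_val_ge0//.
      have [_ <-] := rowP _ (Sin _ i MS); by apply: eq_bigr => j _; rewrite mxE.
    move=> i j; rewrite mxE; have [c _] := rowP _ (Sin _ i MS).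
    by apply: height_code_val (c j) _; rewrite -ltnS ltn_divLR.
  by rewrite card_in_imfset//= -cardE.
by rewrite cardsE card_ffun_on card_ord.
Qed.

(** * Evaluating expressions on the register machine *)

(** In terms of complete runs, because [runs] only describes halting
computations: from the second configuration onwards every run extends backwards
to the first, at additional cost t. *)
Definition reach p pc m pc' m' t :=
  forall mf tf, runs p pc' m' mf tf -> runs p pc m mf (t + tf).

Definition occurs (c : seq instr) (p : program) (pc : nat) :=
  exists p1 p2, p = p1 ++ c ++ p2 /\ size p1 = pc.

Lemma occurs_cat c1 c2 p pc : occurs (c1 ++ c2) p pc ->
  occurs c1 p pc /\ occurs c2 p (pc + size c1).
Proof.
move=> [p1 [p2 [-> <-]]]; split; first by exists p1, (c2 ++ p2); rewrite -!catA.
by exists (p1 ++ c1), p2; rewrite -!catA size_cat.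
Qed.

Lemma reach_trans p pc1 m1 t1 pc2 m2 t2 pc3 m3 :
  reach p pc1 m1 pc2 m2 t1 -> reach p pc2 m2 pc3 m3 t2 ->
  reach p pc1 m1 pc3 m3 (t1 + t2).
Proof. by move=> r12 r23 mf tf /r23/r12; rewrite addnA. Qed.

Lemma reach_instr c p pc m : occurs [:: c] p pc ->
  reach p pc m (next_pc c pc m) (exec_mem c m) (bit_cost c m).
Proof.
move=> [p1 [p2 [pE szE]]] mf tf rn.
have ltp : pc < size p by rewrite pE !size_cat -szE /= addnS ltnS leq_addr.
have nthE : nth (IJump 0) p pc = c by rewrite pE nth_cat szE ltnn subnn.
by rewrite -nthE; apply: runs_step; rewrite ?nthE.
Qed.

Fixpoint straight (s : seq instr) (m : memory) : memory :=
  if s is c :: s' then straight s' (exec_mem c m) else m.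

Fixpoint straight_cost (s : seq instr) (m : memory) : nat :=
  if s is c :: s' then bit_cost c m + straight_cost s' (exec_mem c m) else 0.

Definition is_jump c := match c with IJump _ | IJzero _ _ => true | _ => false end.

Lemma straight_cat s1 s2 m : straight (s1 ++ s2) m = straight s2 (straight s1 m).
Proof. by elim: s1 m => [//|c s1 IH] m /=. Qed.

Lemma straight_cost_cat s1 s2 m : straight_cost (s1 ++ s2) m =
  straight_cost s1 m + straight_cost s2 (straight s1 m).
Proof. by elim: s1 m => [//|c s1 IH] m /=; rewrite IH addnA. Qed.

Lemma reach_straight s p pc m : all (predC is_jump) s -> occurs s p pc ->
  reach p pc m (pc + size s) (straight s m) (straight_cost s m).
Proof.
elim: s pc m => [|c s IH] pc m /=; first by rewrite addn0 => _ _ mf tf.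
case/andP=> nj js; rewrite -cat1s => /occurs_cat[oc os].
have pcE : next_pc c pc m = pc + 1 by rewrite addn1; case: c nj {oc os IH}.
have r1 := @reach_instr c p pc m oc; rewrite pcE in r1; apply: (reach_trans r1).
have -> : pc + (size s).+1 = pc + 1 + size s by rewrite addnS addn1.
exact: IH js os.
Qed.

Lemma bitlen_gt0 x : 0 < bitlen x. Proof. by []. Qed.

Lemma bitlen_le x w : 0 < w -> (bitlen x <= w) = (x < 2 ^ w).
Proof.
move=> w0; apply/idP/idP => [le|lt].
  apply: leq_trans (trunc_log_ltn x (isT : 1 < 2)) _.
  by rewrite leq_exp2l.
rewrite /bitlen; case: x lt => [|x] lt; first by rewrite trunc_log0.
rewrite -(ltn_exp2l (trunc_log 2 x.+1) w (isT : 1 < 2)).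
by apply: leq_ltn_trans lt; apply: trunc_logP.
Qed.

Lemma ltn_bitlen x : x < 2 ^ bitlen x.
Proof. by rewrite -bitlen_le. Qed.

Lemma leq_bitlen x y : x <= y -> bitlen x <= bitlen y.
Proof. by move=> xy; rewrite bitlen_le// (leq_ltn_trans xy)// ltn_bitlen. Qed.

Lemma bitlenD x y : bitlen (x + y) <= bitlen x + bitlen y.
Proof.
rewrite bitlen_le// expnD.
have := ltn_bitlen x; have := ltn_bitlen y.
case: (bitlen x) (bitlen_gt0 x) => // a _; case: (bitlen y) (bitlen_gt0 y) => // b _.
by rewrite !expnS; have := expn_gt0 2 a; have := expn_gt0 2 b; nia.
Qed.

Lemma bitlenM x y : bitlen (x * y) <= bitlen x + bitlen y.
Proof. by rewrite bitlen_le// expnD ltn_mul// ltn_bitlen. Qed.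

Inductive binop := OAdd | OSub | OMul | ODiv.

Definition binop_fun o : nat -> nat -> nat :=
  match o with OAdd => addn | OSub => subn | OMul => muln | ODiv => divn end.

Definition binop_instr o : nat -> nat -> nat -> instr :=
  match o with OAdd => IAdd | OSub => ISub | OMul => IMul | ODiv => IDiv end.

Lemma bitlen_binop o x y : bitlen (binop_fun o x y) <= bitlen x + bitlen y.
Proof.
case: o => /=; first exact: bitlenD.
- by apply: leq_trans (leq_addr _ _); apply: leq_bitlen; apply: leq_subr.
- exact: bitlenM.
- by apply: leq_trans (leq_addr _ _); apply: leq_bitlen; apply: leq_div.
Qed.

Inductive expr :=
| Const of nat
| Var of nat
| Bin of binop & expr & expr
| Fetch of expr.

Fixpoint eval (v h : nat -> nat) e :=
  match e with
  | Const c => c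
  | Var i => v i
  | Bin o a b => binop_fun o (eval v h a) (eval v h b)
  | Fetch a => h (eval v h a)
  end.

(** Even registers hold the variables and the temporaries, odd registers the heap.
As both are unbounded, an expression of any depth can be evaluated and no heap
address clashes with a temporary. *)
Definition layout (v h : nat -> nat) : memory :=
  fun j => if odd j then h j./2 else v j./2.

Definition reg i := i.*2.
Arguments reg : simpl never.
Arguments set_reg : simpl never.
Arguments layout : simpl never.

Lemma layout_var v h i : layout v h (reg i) = v i.
Proof. by rewrite /layout /reg odd_double doubleK. Qed.

Lemma layout_heap v h i : layout v h i.*2.+1 = h i.
Proof. by rewrite /layout /= odd_double /= uphalf_double. Qed.

Lemma set_layout_var v h i x :
  set_reg (layout v h) (reg i) x = layout (set_reg v i x) h.
Proof.
apply: funext => j; rewrite /set_reg /layout /reg.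
case: ifP => [/eqP->|ne]; first by rewrite odd_double doubleK eqxx.
case: ifP => // jo; case: ifP => // /eqP ji.
by move: ne; rewrite -ji -[j in j == _]odd_double_half jo eqxx.
Qed.

Lemma set_layout_heap v h i x :
  set_reg (layout v h) i.*2.+1 x = layout v (set_reg h i x).
Proof.
apply: funext => j; rewrite /set_reg /layout /reg.
case: ifP => [/eqP->|ne]; first by rewrite /= odd_double /= uphalf_double eqxx.
case: ifP => // jo; case: ifP => // /eqP ji.
by move: ne; rewrite -ji -[j in j == _]odd_double_half jo eqxx.
Qed.

(** Replaces the number a in temporary t by 2a + 1, the register of heap cell a. *)
Definition to_heap t :=
  [:: IAdd (reg t) (reg t) (reg t); IConst (reg t.+1) 1; IAdd (reg t) (reg t) (reg t.+1);
      IConst (reg t.+1) 0].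

Arguments to_heap : simpl never.

(** Leaves the value in temporary t and resets the temporaries above t to 0;
[Var] relies on a zero in t to copy by addition. *)
Fixpoint expr_code e t :=
  match e with
  | Const c => [:: IConst (reg t) c]
  | Var i => [:: IAdd (reg t) (reg i) (reg t)]
  | Bin o a b => expr_code a t ++ expr_code b t.+1 ++
      [:: binop_instr o (reg t) (reg t) (reg t.+1); IConst (reg t.+1) 0]
  | Fetch a => (expr_code a t ++ to_heap t) ++ [:: ILoad (reg t) (reg t)]
  end.

Definition clean t (v : nat -> nat) := forall j, t <= j -> v j = 0.

Lemma set_regxx (m : memory) i x y : set_reg (set_reg m i x) i y = set_reg m i y.
Proof. by apply: funext => j; rewrite /set_reg; case: eqP. Qed.

Lemma set_reg_id (m : memory) i x : m i = x -> set_reg m i x = m.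
Proof. by move=> <-; apply: funext => j; rewrite /set_reg; case: eqP => [->|]. Qed.

Lemma set_regC (m : memory) i j x y : i != j ->
  set_reg (set_reg m i x) j y = set_reg (set_reg m j y) i x.
Proof.
move=> ij; apply: funext => k; rewrite /set_reg.
by case: (eqVneq k j) => // ->; rewrite eq_sym (negPf ij).
Qed.

Lemma set_regE (m : memory) i x j : set_reg m i x j = if j == i then x else m j.
Proof. by []. Qed.

Lemma clean_set t v x : clean t v -> clean t.+1 (set_reg v t x).
Proof.
move=> cl j tj; rewrite /set_reg gtn_eqF// cl//; exact: ltnW.
Qed.

Fixpoint vars_below n e :=
  match e with
  | Const _ => true
  | Var i => i < n
  | Bin _ a b => vars_below n a && vars_below n b
  | Fetch a => vars_below n a
  end.

Lemma eval_set n v h t x e : vars_below n e -> n <= t ->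
  eval (set_reg v t x) h e = eval v h e.
Proof.
move=> + nt; elim: e => [c|i|o a IHa b IHb|a IHa] //=.
- by move=> iN; rewrite /set_reg ltn_eqF// (leq_trans iN).
- by move=> /andP[/IHa-> /IHb->].
- by move=> /IHa->.
Qed.

Definition simpreg := (set_layout_var, set_layout_heap, layout_var, layout_heap).

Lemma straight_to_heap v h t : clean t.+1 v ->
  straight (to_heap t) (layout v h) = layout (set_reg v t (v t).*2.+1) h.
Proof.
move=> cl; rewrite /to_heap /= !simpreg.
rewrite (set_regC _ _ _ (i := t.+1)) ?set_regxx; last by rewrite gtn_eqF.
rewrite !set_regE !eqxx ltn_eqF// addnn addn1.
by rewrite set_regC ?neq_ltn ?ltnSn// (@set_reg_id v) // cl.
Qed.

(** Temporaries above t are back to 0 afterwards: the only trace of an evaluation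
is its value, so states between commands are known exactly. *)
Lemma straight_expr n e t v h : n <= t -> vars_below n e -> clean t v ->
  straight (expr_code e t) (layout v h) = layout (set_reg v t (eval v h e)) h.
Proof.
elim: e t v => [c|i|o a IHa b IHb|a IHa] t v nt /=.
- by rewrite !simpreg.
- by move=> _ cl; rewrite !simpreg (cl t)// addn0.
- move=> /andP[na nb] cl; rewrite !straight_cat IHa//.
  rewrite IHb//; [|exact: leqW|exact: clean_set].
  rewrite (eval_set _ _ _ nb)//=.
  have -> m : exec_mem (binop_instr o (reg t) (reg t) (reg t.+1)) m =
      set_reg m (reg t) (binop_fun o (m (reg t)) (m (reg t.+1))) by case: o.
  rewrite !simpreg !set_regE !eqxx ltn_eqF//.
  rewrite (set_regC _ _ _ (i := t.+1)) ?gtn_eqF// !set_regxx.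
  by rewrite set_regC ?neq_ltn ?ltnSn// (@set_reg_id v)// cl.
- move=> na cl; rewrite !straight_cat IHa// straight_to_heap; last exact: clean_set.
  by rewrite set_regxx set_regE eqxx /= !simpreg set_regE eqxx layout_heap set_regxx.
Qed.

Lemma clean_set_low t v i x : clean t v -> i < t -> clean t (set_reg v i x).
Proof.
by move=> cl it j tj; rewrite set_regE gtn_eqF ?cl// (leq_trans it).
Qed.

Lemma expr_code_straight e t : all (predC is_jump) (expr_code e t).
Proof.
elim: e t => [c|i|o a IHa b IHb|a IHa] t //=; rewrite !all_cat ?IHa ?IHb//=.
by case: o.
Qed.

(** How many times longer than the stored numbers a value can be.  A fetched number
is a stored one, however long its address. *)
Fixpoint expr_len e :=
  match e with
  | Const c => bitlen c
  | Var _ => 1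
  | Bin _ a b => expr_len a + expr_len b
  | Fetch _ => 1
  end.

Definition bounded w (v h : nat -> nat) :=
  (forall i, bitlen (v i) <= w) /\ (forall i, bitlen (h i) <= w).

Lemma bounded_gt0 w v h : bounded w v h -> 0 < w.
Proof. by move=> [/(_ 0) bv _]; apply: leq_trans bv. Qed.

(** Each operation at most adds the bit lengths of its operands. *)
Lemma bitlen_eval w v h e : bounded w v h -> bitlen (eval v h e) <= expr_len e * w.
Proof.
move=> bd; have w0 := bounded_gt0 bd; case: (bd) => bv bh.
elim: e => [c|i|o a IHa b IHb|a IHa] /=.
- by rewrite leq_pmulr.
- by rewrite mul1n.
- by rewrite mulnDl (leq_trans (bitlen_binop _ _ _))// leq_add.
- by rewrite mul1n.
Qed.

Definition to_heap_cost s := 10 * (s + 1).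

Lemma straight_to_heap_cost v h t w s : clean t.+1 v -> 0 < w -> bitlen (v t) <= s * w ->
  straight_cost (to_heap t) (layout v h) <= to_heap_cost s * w ^ 2.
Proof.
move=> cl w0 sv; rewrite /to_heap /= !simpreg.
rewrite !set_regE !eqxx ltn_eqF//.
have b1 : bitlen 1 = 1 by []. have b0 : bitlen 0 = 1 by [].
have := bitlenD (v t) (v t).
rewrite b1 b0 /to_heap_cost; set A := bitlen (_ + _); move=> H.
have s0 := leq_trans (bitlen_gt0 (v t)) sv.
rewrite -mulnn; nia.
Qed.

Fixpoint expr_cost e :=
  match e with
  | Const c => bitlen c
  | Var _ => 2
  | Bin o a b => expr_cost a + expr_cost b +
      (expr_len a + expr_len b + expr_len a * expr_len b + 1)
  | Fetch a => expr_cost a + (to_heap_cost (expr_len a) + (expr_len a + 3))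
  end.

Lemma binop_cost o i j k m : bit_cost (binop_instr o i j k) m <=
  bitlen (m j) + bitlen (m k) + bitlen (m j) * bitlen (m k).
Proof. by case: o => /=; rewrite ?leq_addr ?leq_addl. Qed.

Lemma bitlen_doubleS x : bitlen x.*2.+1 <= bitlen x + 1.
Proof. by rewrite bitlen_le ?addn1// expnS mul2n -doubleS leq_double ltn_bitlen. Qed.

(** The variables are read from v', which differs from v by the temporaries in
use; these may be longer than w bits, so the bound refers to v. *)
Lemma straight_expr_cost n e t v' v h w : bounded w v h ->
  (forall j, j < n -> v' j = v j) -> n <= t -> vars_below n e -> clean t v' ->
  straight_cost (expr_code e t) (layout v' h) <= expr_cost e * w ^ 2.
Proof.
move=> bd; have w0 := bounded_gt0 bd; case: (bd) => bv bh.
have w20 : 0 < w ^ 2 by rewrite expn_gt0 w0.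
have ww : w <= w ^ 2 by rewrite -mulnn leq_pmulr.
have evE u e' : (forall j, j < n -> u j = v j) -> vars_below n e' ->
    eval u h e' = eval v h e'.
  move=> vE; elim: e' => [c|i|o a IHa b IHb|a IHa] //=; first by move=> /vE.
    by move=> /andP[/IHa-> /IHb->].
  by move=> /IHa->.
elim: e t v' => [c|i|o a IHa b IHb|a IHa] t v' vE nt /=.
- by rewrite addn0 leq_pmulr.
- move=> iN cl; rewrite addn0 !simpreg (cl t)// vE//.
  by have := bv i; have -> : bitlen 0 = 1 by []; lia.
- move=> /andP[na nb] cl; rewrite !straight_cost_cat (straight_expr _ nt)//.
  have nt1 := leqW nt.
  have vE' : forall j, j < n -> set_reg v' t (eval v' h a) j = v j.
    by move=> j jn; rewrite set_regE ltn_eqF ?vE// (leq_trans jn).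
  rewrite (straight_expr _ nt1)//; last exact: clean_set.
  have ca := IHa t v' vE nt na cl.
  have cb := IHb t.+1 _ vE' nt1 nb (clean_set (eval v' h a) cl).
  rewrite [straight_cost [:: _; _] _]/= addn0 addnA !mulnDl -!mulnDl.
  have -> : bitlen 0 = 1 by [].
  have cE := binop_cost o (reg t) (reg t) (reg t.+1)
    (layout (set_reg (set_reg v' t (eval v' h a)) t.+1
      (eval (set_reg v' t (eval v' h a)) h b)) h).
  rewrite !layout_var !set_regE !eqxx ltn_eqF// in cE.
  rewrite (evE _ _ vE' nb) (evE _ _ vE na) in cE.
  have := bitlen_eval a bd; have := bitlen_eval b bd.
  rewrite (evE _ _ vE' nb) (evE _ _ vE na).
  rewrite !(evE _ _ vE na) in cb.
  set A := bitlen (eval _ _ a) in cE *; set Bl := bitlen (eval _ _ b) in cE *.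
  move=> HB HA.
  have HAB : A * Bl <= expr_len a * expr_len b * w ^ 2.
    by rewrite -mulnn mulnACA leq_mul.
  have HA2 : A <= expr_len a * w ^ 2 by apply: leq_trans HA _; rewrite leq_mul2l ww orbT.
  have HB2 : Bl <= expr_len b * w ^ 2 by apply: leq_trans HB _; rewrite leq_mul2l ww orbT.
  move: (bit_cost _ _) cE => x cE; rewrite !mulnDl mul1n.
  move: ca cb. move: (straight_cost _ _) (straight_cost _ _) => y z ca cb. lia.
- move=> na cl; rewrite !straight_cost_cat straight_cat (straight_expr _ nt)//.
  rewrite straight_to_heap; last exact: clean_set.
  have ca := IHa t v' vE nt na cl.
  have ba := bitlen_eval a bd.
  have ch : straight_cost (to_heap t) (layout (set_reg v' t (eval v' h a)) h) <=
      to_heap_cost (expr_len a) * w ^ 2.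
    apply: straight_to_heap_cost => //; first exact: clean_set.
    by rewrite set_regE eqxx (evE _ _ vE na).
  rewrite [straight_cost [:: _] _]/= addn0 !layout_var set_regxx !set_regE !eqxx layout_heap.
  have b2 := bitlen_doubleS (eval v' h a); rewrite (evE _ _ vE na) in b2 ch *.
  have b3 := bh (eval v h a).
  have HA2 : expr_len a * w <= expr_len a * w ^ 2 by rewrite leq_mul2l ww orbT.
  rewrite (mulnDl (expr_cost a)) (mulnDl (to_heap_cost _)) (mulnDl _ 3).
  move: ca ch; move: (straight_cost _ _) (straight_cost _ _) (to_heap_cost _ * _).
  by move=> x y z ca cb; lia.
Qed.

(** * Structured commands *)

Inductive cmd :=
| Assign of nat & expr
| Store of expr & expr
| Seq of cmd & cmd
| While of expr & cmd.

Definition store_tail t :=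
  [:: IStore (reg t) (reg t.+1); IConst (reg t) 0; IConst (reg t.+1) 0].

Definition assign_tail i t :=
  [:: IAdd (reg i) (reg t) (reg t.+1); IConst (reg t) 0].

Section Commands.
Variable n : nat.

Fixpoint code c pc :=
  match c with
  | Assign i e => expr_code e n ++ assign_tail i n
  | Store a b => (expr_code a n ++ to_heap n) ++ (expr_code b n.+1 ++ store_tail n)
  | Seq c1 c2 => let s1 := code c1 pc in s1 ++ code c2 (pc + size s1)
  | While e c =>
      let se := expr_code e n in
      let sc := code c (pc + size se + 2) in
      se ++ [:: IJzero (reg n) (pc + size se + 2 + size sc + 1); IConst (reg n) 0]
         ++ sc ++ [:: IJump pc]
  end.

Definition state : Type := (nat -> nat) * (nat -> nat).

(** The upper bound is in units of w ^ 2, the cost of a product of w-bit numbers;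
the cost t depends neither on the program around c nor on the place of c. *)
Definition exec w c (s s' : state) lo hi :=
  exists t, [/\ lo <= t, t <= hi * w ^ 2 &
    forall p pc, occurs (code c pc) p pc ->
      reach p pc (layout s.1 s.2) (pc + size (code c pc)) (layout s'.1 s'.2) t].

Definition well_formed w (s : state) := clean n s.1 /\ bounded w s.1 s.2.

Definition assign_cost e := expr_cost e + expr_len e + 2.

Lemma exec_assign w i e s : i < n -> vars_below n e -> well_formed w s ->
  exec w (Assign i e) s (set_reg s.1 i (eval s.1 s.2 e), s.2) 0 (assign_cost e).
Proof.
case: s => v h /= iN ne [/= cl bd].
exists (straight_cost (code (Assign i e) 0) (layout v h)); split=> //.
- rewrite straight_cost_cat (straight_expr _ (leqnn n))//.
  have := straight_expr_cost bd (fun j _ => erefl) (leqnn n) ne cl.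
  rewrite /= !simpreg !set_regE eqxx gtn_eqF// (cl n.+1)//.
  have -> : bitlen 0 = 1 by [].
  have w0 := bounded_gt0 bd; have w20 : 0 < w ^ 2 by rewrite expn_gt0 w0.
  have ww : w <= w ^ 2 by rewrite -mulnn leq_pmulr.
  have := bitlen_eval e bd.
  have : expr_len e * w <= expr_len e * w ^ 2 by rewrite leq_mul2l ww orbT.
  rewrite /assign_cost (mulnDl _ 2) (mulnDl (expr_cost e)).
  move: (straight_cost _ _) => x; lia.
- move=> p pc oc.
  have jf : all (predC is_jump) (code (Assign i e) pc).
    by rewrite all_cat expr_code_straight.
  have := @reach_straight _ p pc (layout v h) jf oc.
  rewrite straight_cat (straight_expr _ (leqnn n))//=.
  rewrite !simpreg set_regC ?neq_ltn ?iN// set_regxx !set_regE eqxx gtn_eqF// (cl n.+1)// addn0.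
  by rewrite (@set_reg_id v n)// cl.
Qed.

Definition store_cost a b :=
  expr_cost a + to_heap_cost (expr_len a) + expr_cost b + expr_len a + expr_len b + 3.

Lemma exec_store w a b s : vars_below n a -> vars_below n b -> well_formed w s ->
  exec w (Store a b) s (s.1, set_reg s.2 (eval s.1 s.2 a) (eval s.1 s.2 b)) 0
    (store_cost a b).
Proof.
case: s => v h /= na nb [/= cl bd].
have nt := leqnn n; have nt1 := leqnSn n.
have cl1 x : clean n.+1 (set_reg v n x) by exact: clean_set.
have evb x : eval (set_reg v n x) h b = eval v h b by rewrite (eval_set _ _ _ nb).
exists (straight_cost (code (Store a b) 0) (layout v h)); split=> //.
- rewrite /= !straight_cost_cat !straight_cat (straight_expr _ nt)// straight_to_heap//.
  rewrite set_regxx !set_regE eqxx (straight_expr _ nt1)// evb.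
  have c1 := straight_expr_cost bd (fun j _ => erefl) nt na cl.
  have w0 := bounded_gt0 bd; have w20 : 0 < w ^ 2 by rewrite expn_gt0 w0.
  have ww : w <= w ^ 2 by rewrite -mulnn leq_pmulr.
  have ba := bitlen_eval a bd; have bb := bitlen_eval b bd.
  have c2 : straight_cost (to_heap n) (layout (set_reg v n (eval v h a)) h) <=
      to_heap_cost (expr_len a) * w ^ 2.
    by apply: straight_to_heap_cost => //; rewrite set_regE eqxx.
  have vE : forall j, j < n -> set_reg v n (eval v h a).*2.+1 j = v j.
    by move=> j jn; rewrite set_regE ltn_eqF.
  have c3 := straight_expr_cost bd vE nt1 nb (cl1 _).
  rewrite [straight_cost (store_tail _) _]/= !simpreg !set_regE !eqxx ltn_eqF//.
  have -> : bitlen 0 = 1 by [].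
  have := bitlen_doubleS (eval v h a).
  have : expr_len a * w <= expr_len a * w ^ 2 by rewrite leq_mul2l ww orbT.
  have : expr_len b * w <= expr_len b * w ^ 2 by rewrite leq_mul2l ww orbT.
  rewrite /store_cost; move: c1 c2 c3; move: (to_heap_cost _) => q.
  rewrite !(mulnDl _ _ (w ^ 2)).
  move: (straight_cost _ _) (straight_cost _ _) (straight_cost _ _) => x y z; lia.
- move=> p pc oc.
  have jf : all (predC is_jump) (code (Store a b) pc).
    by rewrite !all_cat !expr_code_straight.
  have := @reach_straight _ p pc (layout v h) jf oc.
  rewrite !straight_cat (straight_expr _ nt)// straight_to_heap//.
  rewrite set_regxx !set_regE eqxx (straight_expr _ nt1)// evb.
  rewrite [straight (store_tail n) _]/= !simpreg !set_regE !eqxx ltn_eqF//.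
  rewrite set_layout_heap !simpreg.
  rewrite (set_regC _ _ _ (i := n.+1)) ?gtn_eqF// !set_regxx.
  by rewrite (@set_reg_id v n) ?cl// (@set_reg_id v n.+1) ?cl.
Qed.

Lemma exec_seq w c1 c2 s1 s2 s3 l1 h1 l2 h2 : exec w c1 s1 s2 l1 h1 ->
  exec w c2 s2 s3 l2 h2 -> exec w (Seq c1 c2) s1 s3 (l1 + l2) (h1 + h2).
Proof.
move=> [t1 [lt1 ht1 r1]] [t2 [lt2 ht2 r2]]; exists (t1 + t2); split.
- exact: leq_add.
- by rewrite mulnDl leq_add.
- move=> p pc /occurs_cat[/r1 o1 /r2 o2].
  by apply: reach_trans o1 _; rewrite /= size_cat addnA.
Qed.

Definition while_cost e := expr_cost e + expr_len e + 2.

(** The states at the successive tests are given explicitly by S; every iteration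
costs at least 1, which is what makes a loop usable for lower bounds. *)
Lemma exec_while w e c N (S : nat -> state) (cost : nat -> nat) :
  vars_below n e -> (forall i, i <= N -> well_formed w (S i)) ->
  (forall i, i < N -> eval (S i).1 (S i).2 e != 0) ->
  eval (S N).1 (S N).2 e = 0 ->
  (forall i, i < N -> exec w c (S i) (S i.+1) 0 (cost i)) ->
  exec w (While e c) (S 0) (S N) N
    (\sum_(i < N) (cost i + while_cost e) + while_cost e).
Proof.
move=> ne; have nt := leqnn n.
have test s : well_formed w s -> exists t, t + 2 <= while_cost e * w ^ 2 /\ forall p pc,
    occurs (code (While e c) pc) p pc -> let se := expr_code e n in
    reach p pc (layout s.1 s.2) (if eval s.1 s.2 e == 0
       then pc + size (code (While e c) pc) else pc + size se + 2)
      (layout s.1 s.2) (if eval s.1 s.2 e == 0 then t else t.+1).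
  case: s => v h [/= cl bd].
  exists (straight_cost (expr_code e n) (layout v h) + bitlen (eval v h e)); split.
    have := straight_expr_cost bd (fun j _ => erefl) nt ne cl.
    have w0 := bounded_gt0 bd; have w20 : 0 < w ^ 2 by rewrite expn_gt0 w0.
    have ww : w <= w ^ 2 by rewrite -mulnn leq_pmulr.
    have := bitlen_eval e bd.
    have : expr_len e * w <= expr_len e * w ^ 2 by rewrite leq_mul2l ww orbT.
    rewrite /while_cost (mulnDl _ 2) (mulnDl (expr_cost e)).
    move: (straight_cost _ _) => x; lia.
  move=> p pc /occurs_cat[oe]; rewrite -cat1s => /occurs_cat[oz].
  rewrite -cat1s => /occurs_cat[ok _].
  have r1 := @reach_straight _ p pc (layout v h) (expr_code_straight e n) oe.
  rewrite (straight_expr _ nt)// in r1.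
  have := reach_trans r1 (@reach_instr _ p _ _ oz).
  rewrite /= !simpreg set_regE eqxx.
  case: eqP => [e0|ne0] r2.
    move: r2; rewrite e0 (@set_reg_id v n) ?cl// !size_cat /= size_cat /=.
    by congr reach; lia.
  rewrite [size [:: _]]/= addn1 in ok.
  have := reach_trans r2 (@reach_instr _ p _ _ ok).
  by rewrite /= !simpreg set_regxx (@set_reg_id v n) ?cl// addn2 addn1.
elim: N S cost => [|N IH] S cost pS S1 S0 ex.
  have [t [ht r]] := test _ (pS 0 isT).
  exists t; split=> //; first by rewrite big_ord0 add0n; lia.
  by move=> p pc oc; have := r p pc oc; rewrite S0 eqxx.
have [t [ht r]] := test _ (pS 0 isT).
have [t1 [_ ht1 r1]] := ex 0 isT.
have [||||t2 [lt2 ht2 r2]] := IH (fun i => S i.+1) (fun i => cost i.+1).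
- by move=> i iN; apply: pS.
- by move=> i iN; apply: S1.
- exact: S0.
- by move=> i iN; apply: ex.
exists (t.+1 + (t1 + (1 + t2))); split.
- by lia.
- rewrite big_ord_recl (eq_bigr (fun i : 'I_N => cost i.+1 + while_cost e))//.
  move: ht ht1 ht2; move: (while_cost e) (\sum_(i < N) _) => wc sm /= ht ht1.
  rewrite !(mulnDl _ _ (w ^ 2)); lia.
- move=> p pc oc.
  have := r p pc oc; rewrite (negPf (S1 0 isT)) => rt.
  apply: (reach_trans rt).
  have /occurs_cat[_ oc2] := oc.
  have [_ oc3] :=
    @occurs_cat [:: _; _] (code c (pc + size (expr_code e n) + 2) ++ [:: IJump pc]) _ _ oc2.
  have [ob oj] := occurs_cat oc3; apply: (reach_trans (r1 _ _ ob)).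
  apply: (@reach_trans _ _ _ 1 pc (layout (S 1).1 (S 1).2)).
    exact: (@reach_instr _ p _ _ oj).
  exact: r2.
Qed.
End Commands.

(** * Loops and arithmetic expressions *)

Lemma exec_le n w c s s' lo hi lo' hi' : lo' <= lo -> hi <= hi' ->
  exec n w c s s' lo hi -> exec n w c s s' lo' hi'.
Proof.
move=> ll hh [t [lt ht r]]; exists t; split=> //; first exact: leq_trans lt.
by rewrite (leq_trans ht)// leq_mul2r hh orbT.
Qed.

Definition For r b c :=
  Seq (Assign r (Const 0))
      (While (Bin OSub b (Var r)) (Seq c (Assign r (Bin OAdd (Var r) (Const 1))))).

(** A loop body ends before the counter is increased, hence in the next state with
the old value of the counter. *)
Definition set_var (s : state) r x : state := (set_reg s.1 r x, s.2).

Definition for_cost r b := assign_cost (Const 0) +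
  assign_cost (Bin OAdd (Var r) (Const 1)) + while_cost (Bin OSub b (Var r)).

Lemma set_var_id s r x y : s.1 r = y -> set_var (set_var s r x) r y = s.
Proof. by case: s => v h /= vr; rewrite /set_var /= set_regxx set_reg_id. Qed.

Lemma exec_for n w r b c N s (S : nat -> state) cost :
  r < n -> vars_below n b -> well_formed n w s -> S 0 = set_var s r 0 ->
  (forall i, i <= N -> well_formed n w (S i)) ->
  (forall i, i <= N -> (S i).1 r = i) ->
  (forall i, i <= N -> eval (S i).1 (S i).2 b = N) ->
  (forall i, i < N -> exec n w c (S i) (set_var (S i.+1) r i) 0 (cost i)) ->
  exec n w (For r b c) s (S N) 0 (\sum_(i < N) (cost i + for_cost r b) + for_cost r b).
Proof.
move=> rn nb ps S0 pS Sr Sb ex.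
pose cost' i := cost i + assign_cost (Bin OAdd (Var r) (Const 1)).
have ew : exec n w (While (Bin OSub b (Var r)) (Seq c (Assign r (Bin OAdd (Var r) (Const 1)))))
    (S 0) (S N) N (\sum_(i < N) (cost' i + while_cost (Bin OSub b (Var r))) +
      while_cost (Bin OSub b (Var r))).
  apply: exec_while => //=.
  - by rewrite nb.
  - by move=> i iN; rewrite Sb ?(ltnW iN)// Sr ?(ltnW iN)// subn_eq0 -ltnNge.
  - by rewrite Sb// Sr// subnn.
  - move=> i iN; rewrite -[0]addn0; apply: exec_seq (ex i iN) _.
    have := @exec_assign n w r (Bin OAdd (Var r) (Const 1)) (set_var (S i.+1) r i) rn.
    rewrite /= set_regE eqxx rn => /(_ isT).
    rewrite -[X in exec _ _ _ _ X]/(set_var (set_var (S i.+1) r i) r (i + 1)).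
    rewrite set_var_id ?Sr ?addn1//; apply.
    have [/= cl [bv bh]] := pS i.+1 iN; split; first exact: clean_set_low.
    split=> //= j; rewrite set_regE; case: eqP => // _.
    by have := bv r; rewrite Sr//; apply: leq_trans; apply: leq_bitlen.
apply: exec_le (exec_seq _ ew).
- exact: leq0n.
- rewrite (_ : \sum_(i < N) (cost i + for_cost r b) =
     \sum_(i < N) (cost' i + while_cost (Bin OSub b (Var r)) + assign_cost (Const 0))); last first.
    by apply: eq_bigr => i _; rewrite /cost' /for_cost; lia.
  rewrite [in leqRHS]big_split /=; instantiate (1 := assign_cost (Const 0)).
  rewrite [in X in _ <= _ + X]/for_cost; lia.
- rewrite S0; exact: exec_assign.
Qed.

Lemma exec_for_const n w r b c N s (S : nat -> state) cost :
  r < n -> vars_below n b -> well_formed n w s -> S 0 = set_var s r 0 ->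
  (forall i, i <= N -> well_formed n w (S i)) ->
  (forall i, i <= N -> (S i).1 r = i) ->
  (forall i, i <= N -> eval (S i).1 (S i).2 b = N) ->
  (forall i, i < N -> exec n w c (S i) (set_var (S i.+1) r i) 0 cost) ->
  exec n w (For r b c) s (S N) 0 (N.+1 * (cost + for_cost r b)).
Proof.
move=> h1 h2 h3 h4 h5 h6 h7 h8.
apply: exec_le (exec_for h1 h2 h3 h4 h5 h6 h7 h8) => //.
rewrite sum_nat_const card_ord mulSn addnC leq_add2r; exact: leq_addl.
Qed.

Notation "a [+] b" := (Bin OAdd a b) (at level 50, left associativity).
Notation "a [-] b" := (Bin OSub a b) (at level 50, left associativity).
Notation "a [*] b" := (Bin OMul a b) (at level 40, left associativity).
Notation "a [/] b" := (Bin ODiv a b) (at level 40, left associativity).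

Definition mod_expr a b := a [-] (a [/] b) [*] b.

(** Truncated subtraction turns tests into the numbers 0 and 1, which lets loop
bodies do without branching. *)
Definition le_expr a b := Const 1 [-] (a [-] b).
Definition ne0_expr a := Const 1 [-] (Const 1 [-] a).
Definition eq1_expr a := le_expr a (Const 1) [*] ne0_expr a.
Fixpoint pow_expr a k := if k is k'.+1 then a [*] pow_expr a k' else Const 1.
Definition digit_expr b k a := mod_expr (a [/] pow_expr b k) b.

Arguments mod_expr : simpl never.
Arguments le_expr : simpl never.
Arguments ne0_expr : simpl never.
Arguments eq1_expr : simpl never.
Arguments digit_expr : simpl never.

Lemma eval_bin v h o a b : eval v h (Bin o a b) = binop_fun o (eval v h a) (eval v h b).
Proof. by []. Qed.

Section Eval.
Variables v h : nat -> nat.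
Local Notation ev := (eval v h).

Lemma eval_mod a b : ev (mod_expr a b) = ev a %% ev b.
Proof. by rewrite /mod_expr /= {1}(divn_eq (ev a) (ev b)) addKn. Qed.

Lemma eval_le a b : ev (le_expr a b) = (ev a <= ev b).
Proof. by rewrite /le_expr /= -subn_eq0; case: (ev a - ev b) => [|[|?]]. Qed.

Lemma eval_ne0 a : ev (ne0_expr a) = (ev a != 0).
Proof. by rewrite /ne0_expr /=; case: (ev a) => [|[|?]]. Qed.

Lemma eval_eq1 a : ev (eq1_expr a) = (ev a == 1).
Proof.
by rewrite /eq1_expr eval_bin eval_le eval_ne0 /=; case: (ev a) => [|[|?]].
Qed.

Lemma eval_pow a k : ev (pow_expr a k) = ev a ^ k.
Proof. by elim: k => //= k ->; rewrite expnS. Qed.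

Lemma eval_digit b k a : ev (digit_expr b k a) = digit (ev b) k (ev a).
Proof. by rewrite /digit_expr eval_mod eval_bin eval_pow. Qed.
End Eval.

Definition all_coprime (g : nat -> nat) qs := all (fun q => g q == 1) qs.

Fixpoint sum_den_expr b es := if es is e :: es' then e [/] b [*] sum_den_expr b es' else Const 1.
Fixpoint sum_num_expr b es :=
  if es is e :: es' then
    mod_expr e b [*] sum_den_expr b es' [+] sum_num_expr b es' [*] (e [/] b)
  else Const 0.

(** Two tables share the heap: gcds in the even cells, counts in the odd ones. *)
Definition gcd_cell e := Const 2 [*] e.
Definition count_cell e := Const 2 [*] e [+] Const 1.
Arguments gcd_cell : simpl never.
Arguments count_cell : simpl never.
Fixpoint coprime_expr es :=
  if es is e :: es' then eq1_expr (Fetch (gcd_cell e)) [*] coprime_expr es' else Const 1.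

Section EvalFrac.
Variables v g c : nat -> nat.
Local Notation ev := (eval v (layout g c)).

Lemma eval_sum_den b es : ev (sum_den_expr b es) = sum_den (ev b) (map ev es).
Proof. by elim: es => //= e es ->. Qed.

Lemma eval_sum_num b es : ev (sum_num_expr b es) = sum_num (ev b) (map ev es).
Proof.
elim: es => // e es IH; rewrite [sum_num_expr _ _]/= (eval_bin _ _ OAdd) !(eval_bin _ _ OMul).
by rewrite IH eval_mod eval_sum_den.
Qed.

Lemma eval_gcd_cell e : ev (Fetch (gcd_cell e)) = g (ev e).
Proof. by rewrite /gcd_cell /= mul2n layout_var. Qed.

Lemma eval_count_cell e : ev (Fetch (count_cell e)) = c (ev e).
Proof. by rewrite /count_cell /= mul2n addn1 layout_heap. Qed.

Lemma eval_coprime es : ev (coprime_expr es) = all_coprime g (map ev es).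
Proof.
elim: es => // e es IH; rewrite [coprime_expr _]/= (eval_bin _ _ OMul) IH eval_eq1 eval_gcd_cell.
by rewrite /= mulnb.
Qed.
End EvalFrac.

(** * The table of gcds and the table of sums *)

(** Input, outer counter, inner counter and running total. *)
Definition vars H x y s := nth 0 [:: H; x; y; s].
Arguments vars : simpl never.

Lemma set_varsE H x y s i v : i < 4 -> set_reg (vars H x y s) i v =
  vars (if i == 0 then v else H) (if i == 1 then v else x)
       (if i == 2 then v else y) (if i == 3 then v else s).
Proof.
move=> i4; apply: funext => j; rewrite set_regE /vars.
by case: i i4 j => [|[|[|[|?]]]] // _ [|[|[|[|?]]]].
Qed.

Lemma well_formed_vars V H x y s g c :
  [/\ H <= V, x <= V, y <= V & s <= V] -> (forall q, g q <= V) -> (forall q, c q <= V) ->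
  well_formed 4 (bitlen V) (vars H x y s, layout g c).
Proof.
move=> [h1 h2 h3 h4] gV cV; split=> /=.
  by case=> [|[|[|[|j]]]] // _; rewrite /vars /= nth_nil.
split=> i; apply: leq_bitlen; first by case: i => [|[|[|[|i]]]] //=; rewrite /vars /= nth_nil.
by rewrite /layout; case: ifP.
Qed.

Notation base := (Var 0 [+] Const 1).

(** One step of the Euclidean algorithm, the rest being read from the table: with
r and s the digits of the counter, gcd(r, s) = gcd(s, r mod s).  For s = 0 the
value is r, and the second summand vanishes. *)
Definition gcd_expr :=
  let r := Var 1 [/] base in let s := mod_expr (Var 1) base in
  (Const 1 [-] s) [*] r [+] ne0_expr s [*] Fetch (gcd_cell (s [*] base [+] mod_expr r s)).

(** The table after i steps.  Only entries with s <= r are filled in; the recursion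
never needs the others. *)
Definition gcd_table B i q :=
  if (q < i) && (q %% B <= q %/ B) then gcdn (q %/ B) (q %% B) else 0.

Lemma gcd_table0 B : gcd_table B 0 = fun=> 0.
Proof. by apply: funext => q; rewrite /gcd_table ltn0. Qed.

Lemma gcd_tableS B i :
  set_reg (gcd_table B i) i (gcd_table B i.+1 i) = gcd_table B i.+1.
Proof.
apply: funext => q; rewrite set_regE /gcd_table ltnSn ltnS.
by case: eqP => [->|/eqP ne]; rewrite ?leqnn// ltn_neqAle ne.
Qed.

(** For 0 < s <= r the entry for (s, r mod s) is earlier than the one for (r, s).
For r < s the entry read is that of (s, r), still to come, so 0 is written. *)
Lemma gcd_table_rec B i : 0 < B ->
  (1 - i %% B) * (i %/ B) + (i %% B != 0) * gcd_table B i (i %% B * B + (i %/ B) %% (i %% B))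
  = gcd_table B i.+1 i.
Proof.
move=> B0; set r := i %/ B; set s := i %% B; have sB : s < B by rewrite ltn_pmod.
rewrite [in RHS]/gcd_table ltnSn -/r -/s.
case: (posnP s) => [->|s0]; first by rewrite subn0 gcdn0 mul1n addn0.
have -> : 1 - s = 0 by apply/eqP; rewrite subn_eq0.
rewrite mul0n add0n mul1n /gcd_table.
have ms : r %% s < s by rewrite ltn_pmod.
have mB : r %% s < B by apply: ltn_trans sB.
rewrite divnMDl// modnMDl (divn_small mB) addn0 (modn_small mB) (ltnW ms) andbT.
have iE : i = r * B + s by exact: divn_eq.
move: (r %% s) (gcdn_modr s r) ms mB => m gm ms mB.
case: (ltngtP s r) => [sr|rs|e].
- have -> : s * B + m < i.
    have : s.+1 * B <= r * B by rewrite leq_mul2r sr orbT.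
    by rewrite mulSn iE; lia.
  by rewrite gm gcdnC.
- rewrite ltnNge (_ : i <= _)//.
  have : r.+1 * B <= s * B by rewrite leq_mul2r rs orbT.
  by rewrite mulSn iE; lia.
- by rewrite gm e gcdnn iE -e ltn_add2l ms.
Qed.

Lemma gcd_table_le B i q : 0 < B -> i <= B * B -> gcd_table B i q <= B.
Proof.
move=> B0 iB; rewrite /gcd_table; case: ifP => // /andP[qi sr].
have rB : q %/ B < B by rewrite ltn_divLR// (leq_trans qi).
case: (posnP (q %/ B)) => [r0|r0]; first by move: sr; rewrite r0 leqn0 => /eqP->.
by apply: leq_trans (ltnW rB); rewrite dvdn_leq// dvdn_gcdl.
Qed.

(** Entries outside s <= r being 0, one comparison with 1 tests both conditions. *)
Lemma gcd_table_coprime B q : q < B * B ->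
  (gcd_table B (B * B) q == 1) = reduced_code B q.
Proof.
by move=> qB; rewrite /gcd_table qB /reduced_code /coprime; case: (_ <= _).
Qed.

Definition gcd_cmd := For 1 (base [*] base) (Store (gcd_cell (Var 1)) gcd_expr).
Definition gcd_cost := store_cost (gcd_cell (Var 1)) gcd_expr + for_cost 1 (base [*] base).

Definition no_count : nat -> nat := fun=> 0.

Lemma exec_gcd V H : let B := H.+1 in B * B <= V ->
  exec 4 (bitlen V) gcd_cmd (vars H 0 0 0, fun=> 0)
    (vars H (B * B) 0 0, layout (gcd_table B (B * B)) no_count)
    0 ((B * B).+1 * gcd_cost).
Proof.
move=> B BV; have B0 : 0 < B by [].
have h0 : layout (gcd_table B 0) no_count = fun=> 0.
  by rewrite gcd_table0; apply: funext => j; rewrite /layout /no_count; case: ifP.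
have wf i : i <= B * B -> well_formed 4 (bitlen V)
    (vars H i 0 0, layout (gcd_table B i) no_count).
  move=> iB; apply: well_formed_vars => //.
    by split=> //; [rewrite (leq_trans _ BV)// /B; lia | exact: leq_trans BV].
  by move=> q; rewrite (leq_trans (gcd_table_le _ B0 iB))// (leq_trans _ BV)// leq_pmull.
rewrite -h0.
apply: (exec_for_const (S := fun i => (vars H i 0 0, layout (gcd_table B i) no_count))) => //.
- exact: wf.
- by rewrite /set_var /= set_varsE.
- by move=> i _; rewrite /= /vars /= addn1.
- move=> i iB.
  have := @exec_store 4 (bitlen V) (gcd_cell (Var 1)) gcd_expr _ isT isT (wf i (ltnW iB)).
  have -> : eval (vars H i 0 0) (layout (gcd_table B i) no_count) gcd_expr = gcd_table B i.+1 i.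
    rewrite /gcd_expr eval_bin !(eval_bin _ _ OMul) (eval_bin _ _ OSub) eval_ne0 eval_gcd_cell.
    rewrite (eval_bin _ _ OAdd) !(eval_bin _ _ OMul) !eval_mod.
    rewrite !(eval_bin _ _ ODiv) (eval_bin _ _ OAdd) /=.
    by rewrite -gcd_table_rec// /vars /= addn1.
  rewrite /= /gcd_cell /= mul2n {1}/vars /= -[i.*2]/(reg i) set_layout_var gcd_tableS.
  by rewrite /set_var /= set_varsE.
Qed.

(** The power B ^ n bounds every denominator of a sum of at most n fractions. *)
Definition key_expr n a d := a [*] pow_expr (pow_expr base n) 2 [/] d.
Arguments key_expr : simpl never.

Definition flat_codes k := [seq digit_expr (base [*] base) i (Var 1) | i <- iota 0 k].
Definition flat_cell n k :=
  count_cell (key_expr n (sum_num_expr base (flat_codes k))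
    (sum_den_expr base (flat_codes k))).

Definition count_table B n k i a := \sum_(x < i)
  (tuple_key B n (digits (B * B) k x) == a) * all (reduced_code B) (digits (B * B) k x).

Lemma eval_key v h n a d : eval v h (key_expr n a d) =
  key (eval v h base ^ n) (eval v h a) (eval v h d).
Proof.
by rewrite /key_expr (eval_bin _ _ ODiv) (eval_bin _ _ OMul) !eval_pow.
Qed.

Lemma vars_pow n e k : vars_below n e -> vars_below n (pow_expr e k).
Proof. by move=> ne; elim: k => //= k ->; rewrite ne. Qed.

Lemma vars_mod n a b : vars_below n a -> vars_below n b -> vars_below n (mod_expr a b).
Proof. by move=> /= -> ->. Qed.

Lemma vars_digit n b i a : vars_below n b -> vars_below n a -> vars_below n (digit_expr b i a).
Proof. by move=> nb na; rewrite /digit_expr vars_mod//= na vars_pow. Qed.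

Lemma vars_sum_den n b es : vars_below n b -> all (vars_below n) es ->
  vars_below n (sum_den_expr b es).
Proof. by move=> nb; elim: es => //= e es IH /andP[-> /IH->]; rewrite nb. Qed.

Lemma vars_sum_num n b es : vars_below n b -> all (vars_below n) es ->
  vars_below n (sum_num_expr b es).
Proof.
move=> nb; elim: es => //= e es IH /andP[ne nes].
by rewrite IH// vars_sum_den// ne nb.
Qed.

Lemma vars_coprime n es : all (vars_below n) es -> vars_below n (coprime_expr es).
Proof. by elim: es => //= e es IH /andP[ne /IH->]; rewrite ne. Qed.

Lemma vars_key n m a d : 0 < n -> vars_below n a -> vars_below n d -> vars_below n (key_expr m a d).
Proof. by move=> n0 na nd; rewrite /key_expr /= na nd vars_pow //= n0. Qed.

Lemma vars_cell n e : vars_below n (count_cell e) = vars_below n e.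
Proof. by rewrite /count_cell /= andbT. Qed.

Lemma vars_flat k : all (vars_below 4) (flat_codes k).
Proof. by rewrite all_map; apply/allP => i _; apply: vars_digit. Qed.

Lemma vars_flat_cell n k : vars_below 4 (flat_cell n k).
Proof. by rewrite vars_cell vars_key ?vars_sum_num ?vars_sum_den ?vars_flat. Qed.

Lemma eval_flat_codes H x y s h k :
  map (eval (vars H x y s) h) (flat_codes k) = digits (H.+1 * H.+1) k x.
Proof.
rewrite -map_comp; apply: eq_map => i.
rewrite -[LHS]/(eval (vars H x y s) h (digit_expr (base [*] base) i (Var 1))).
by rewrite eval_digit /= /vars /= addn1.
Qed.

Lemma all_coprime_table B qs : all (fun q => q < B * B) qs ->
  all_coprime (gcd_table B (B * B)) qs = all (reduced_code B) qs.
Proof.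
by elim: qs => //= q qs IH /andP[qB /IH->]; rewrite gcd_table_coprime.
Qed.

Lemma digits_lt b k x : 0 < b -> all (fun d => d < b) (digits b k x).
Proof. by move=> b0; apply/allP => _ /mapP[i _ ->]; rewrite ltn_pmod. Qed.

Lemma count_tableS B n k i :
  set_reg (count_table B n k i) (tuple_key B n (digits (B * B) k i))
    (count_table B n k i (tuple_key B n (digits (B * B) k i)) +
     all (reduced_code B) (digits (B * B) k i)) = count_table B n k i.+1.
Proof.
apply: funext => a; rewrite set_regE /count_table big_ord_recr /= [_ == a]eq_sym.
by case: eqP => [->|_]; rewrite ?mul1n ?addn0.
Qed.

Lemma count_table_le B n k i a : count_table B n k i a <= i.
Proof.
rewrite -[leqRHS]mul1n -[X in _ <= _ * X]card_ord mulnC -sum_nat_const.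
by apply: leq_sum => x _; rewrite mulnb leq_b1.
Qed.

Lemma eval_bE H x y s h : eval (vars H x y s) h base = H.+1.
Proof. by rewrite /= /vars /= addn1. Qed.

Definition count_cmd n k := For 1 (pow_expr (base [*] base) k)
  (Store (flat_cell n k) (Fetch (flat_cell n k) [+] coprime_expr (flat_codes k))).

Definition count_cost n k :=
  store_cost (flat_cell n k) (Fetch (flat_cell n k) [+] coprime_expr (flat_codes k)) +
  for_cost 1 (pow_expr (base [*] base) k).

Lemma exec_count V H n k : let B := H.+1 in B * B <= V -> (B * B) ^ k <= V ->
  exec 4 (bitlen V) (count_cmd n k)
    (vars H (B * B) 0 0, layout (gcd_table B (B * B)) no_count)
    (vars H ((B * B) ^ k) 0 0,
      layout (gcd_table B (B * B)) (count_table B n k ((B * B) ^ k)))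
    0 (((B * B) ^ k).+1 * count_cost n k).
Proof.
move=> B BV BkV; have B0 : 0 < B by [].
have HV : H <= V by rewrite (leq_trans _ BV)// /B; lia.
have gV q : gcd_table B (B * B) q <= V.
  by rewrite (leq_trans (gcd_table_le _ B0 (leqnn _)))// (leq_trans _ BV)// leq_pmull.
have wf i : i <= (B * B) ^ k -> well_formed 4 (bitlen V)
    (vars H i 0 0, layout (gcd_table B (B * B)) (count_table B n k i)).
  move=> iB; have iV := leq_trans iB BkV; apply: well_formed_vars => //.
  by move=> q; apply: leq_trans (count_table_le _ _ _ _ _) iV.
have c0 : no_count = count_table B n k 0.
  by apply: funext => a; rewrite /count_table big_ord0.
rewrite c0.
apply: (exec_for_const (S := fun i =>
  (vars H i 0 0, layout (gcd_table B (B * B)) (count_table B n k i)))) => //.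
- by rewrite vars_pow.
- by rewrite -c0; apply: well_formed_vars.
- by rewrite /set_var /= set_varsE.
- by move=> i _; rewrite eval_pow (eval_bin _ _ OMul) eval_bE.
- move=> i iB; set h := layout _ _; set v := vars H i 0 0.
  have := @exec_store 4 (bitlen V) (flat_cell n k)
    (Fetch (flat_cell n k) [+] coprime_expr (flat_codes k)) (v, h)
    (vars_flat_cell n k) _ (wf i (ltnW iB)).
  rewrite [vars_below _ _]/= vars_coprime ?vars_flat// andbT => /(_ (vars_flat_cell n k)).
  rewrite (eval_bin _ _ OAdd) eval_coprime eval_flat_codes.
  rewrite all_coprime_table; last by rewrite digits_lt.
  have kE : eval v h (key_expr n (sum_num_expr base (flat_codes k))
        (sum_den_expr base (flat_codes k)))
      = tuple_key B n (digits (B * B) k i).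
    by rewrite eval_key eval_sum_num eval_sum_den eval_flat_codes eval_bE.
  rewrite /flat_cell eval_count_cell kE.
  rewrite [eval _ _ (count_cell _)](_ : _ = (tuple_key B n (digits (B * B) k i)).*2.+1); last first.
    by rewrite /count_cell /= mul2n addn1 -kE.
  by rewrite /= /h set_layout_heap count_tableS /set_var /= set_varsE.
Qed.

(** * The search for complementary sums *)

Definition pair_codes l :=
  [seq digit_expr base i (Var 1) [*] base [+] digit_expr base i (Var 2) | i <- iota 0 l].

Definition match_expr n l :=
  let a := sum_num_expr base (pair_codes l) in
  let d := sum_den_expr base (pair_codes l) in
  coprime_expr (pair_codes l) [*] le_expr a d [*]
    Fetch (count_cell (key_expr n (d [-] a) d)).

Definition match_count B n k qs :=
  all (reduced_code B) qs * (sum_num B qs <= sum_den B qs) *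
    count_table B n k ((B * B) ^ k) (compl_key B n qs).

Definition match_cmd n l flag := For 1 (pow_expr base l)
  (For 2 (flag [*] pow_expr base l) (Assign 3 (Var 3 [+] match_expr n l))).

Lemma vars_pair_codes l : all (vars_below 4) (pair_codes l).
Proof.
rewrite all_map; apply/allP => i _.
rewrite -[preim _ _ _]/(vars_below 4 (digit_expr base i (Var 1)) && true &&
  vars_below 4 (digit_expr base i (Var 2))).
by rewrite !vars_digit.
Qed.

Lemma vars_match n l : vars_below 4 (match_expr n l).
Proof.
have vd : vars_below 4 (sum_den_expr base (pair_codes l)) by rewrite vars_sum_den ?vars_pair_codes.
have vn : vars_below 4 (sum_num_expr base (pair_codes l)) by rewrite vars_sum_num ?vars_pair_codes.
rewrite /match_expr.
have -> a b c : vars_below 4 (a [*] b [*] Fetch c) =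
  [&& vars_below 4 a, vars_below 4 b & vars_below 4 c] by rewrite /= andbA.
by rewrite vars_coprime ?vars_pair_codes// vars_cell vars_key /= ?vn ?vd.
Qed.

Lemma eval_pair_codes H y z s h l :
  map (eval (vars H y z s) h) (pair_codes l) = pair_digits H.+1 l y z.
Proof.
rewrite -map_comp; apply: eq_map => i.
rewrite -[LHS]/(eval (vars H y z s) h
  (digit_expr base i (Var 1) [*] base [+] digit_expr base i (Var 2))).
by rewrite (eval_bin _ _ OAdd) (eval_bin _ _ OMul) !eval_digit eval_bE.
Qed.

Lemma pair_digits_lt B l y z : 0 < B -> all (fun q => q < B * B) (pair_digits B l y z).
Proof.
move=> B0; apply/allP => _ /mapP[i _ ->]; rewrite /digit.
have h1 := ltn_pmod (y %/ B ^ i) B0; have h2 := ltn_pmod (z %/ B ^ i) B0.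
have : (y %/ B ^ i %% B).+1 * B <= B * B by rewrite leq_mul2r h1 orbT.
by rewrite mulSn; lia.
Qed.

Lemma eval_match H y z s n k l : let B := H.+1 in
  eval (vars H y z s) (layout (gcd_table B (B * B)) (count_table B n k ((B * B) ^ k)))
    (match_expr n l) = match_count B n k (pair_digits B l y z).
Proof.
move=> B; rewrite /match_expr !(eval_bin _ _ OMul) eval_coprime eval_le eval_count_cell.
rewrite eval_key (eval_bin _ _ OSub) eval_sum_num eval_sum_den eval_pair_codes eval_bE.
by rewrite all_coprime_table ?pair_digits_lt.
Qed.

Lemma match_count_le B n k qs : match_count B n k qs <= (B * B) ^ k.
Proof.
by rewrite /match_count mulnb -[leqRHS]mul1n leq_mul ?leq_b1// count_table_le.
Qed.

Definition inner_cost n l flag :=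
  assign_cost (Var 3 [+] match_expr n l) + for_cost 2 (flag [*] pow_expr base l).

Definition outer_cost n l flag :=
  inner_cost n l flag + for_cost 1 (pow_expr base l).

(** The iterations are counted by N, so that a skipped tuple of denominators
costs only a constant number of steps. *)
Lemma exec_match V H n k l flag (fl : seq nat -> bool) : let B := H.+1 in
  let h := layout (gcd_table B (B * B)) (count_table B n k ((B * B) ^ k)) in
  let N y := fl (digits B l y) * B ^ l in
  vars_below 4 flag ->
  (forall y z s, y < B ^ l -> eval (vars H y z s) h flag = fl (digits B l y)) ->
  B * B <= V -> (B * B) ^ (l + k) <= V ->
  exists z, z <= V /\ exec 4 (bitlen V) (match_cmd n l flag)
    (vars H ((B * B) ^ k) 0 0, h)
    (vars H (B ^ l) z (\sum_(y < B ^ l) \sum_(z < N y)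
       match_count B n k (pair_digits B l y z)), h)
    0 ((\sum_(y < B ^ l) (N y).+1 + 1) * outer_cost n l flag).
Proof.
move=> B h N vf flE BV BkV; have B0 : 0 < B by [].
have HV : H <= V by rewrite (leq_trans _ BV)// /B; lia.
have gV q : gcd_table B (B * B) q <= V.
  by rewrite (leq_trans (gcd_table_le _ B0 (leqnn _)))// (leq_trans _ BV)// leq_pmull.
have kV : (B * B) ^ k <= V.
  by apply: leq_trans BkV; rewrite leq_pexp2l ?muln_gt0// leq_addl.
have lV : B ^ l <= V.
  apply: leq_trans BkV; rewrite (@leq_trans ((B * B) ^ l))//.
    by rewrite expnMn leq_pmull// expn_gt0.
  by rewrite leq_pexp2l ?muln_gt0// leq_addr.
have cV q : count_table B n k ((B * B) ^ k) q <= V.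
  exact: leq_trans (count_table_le _ _ _ _ _) kV.
have wf x y s : x <= V -> y <= V -> s <= V -> well_formed 4 (bitlen V) (vars H x y s, h).
  by move=> *; apply: well_formed_vars.
have NB y : N y <= B ^ l by rewrite /N; case: (fl _); rewrite ?mul1n.
pose F y z := match_count B n k (pair_digits B l y z).
pose total y := \sum_(i < y) \sum_(z < N i) F i z.
have FS y j : j <= B ^ l -> \sum_(z < j) F y z <= B ^ l * (B * B) ^ k.
  move=> jB; apply: (@leq_trans (\sum_(z < j) (B * B) ^ k)).
    by apply: leq_sum => z _; apply: match_count_le.
  by rewrite sum_nat_const card_ord leq_mul2r jB orbT.
have totalS y : total y <= y * (B ^ l * (B * B) ^ k).
  apply: (@leq_trans (\sum_(i < y) B ^ l * (B * B) ^ k)).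
    by apply: leq_sum => i _; apply: FS.
  by rewrite sum_nat_const card_ord.
have VE : (B * B) ^ (l + k) = B ^ l * (B ^ l * (B * B) ^ k).
  by rewrite expnD expnMn mulnA.
(* The inner counter keeps its final value from the previous outer iteration. *)
pose last_z y := if y is y'.+1 then N y' else 0.
have totV y : y <= B ^ l -> total y <= V.
  move=> yB; apply: leq_trans (totalS y) _; apply: leq_trans BkV.
  by rewrite VE leq_mul2r yB orbT.
have lastV y : last_z y <= V by case: y => //= y; apply: leq_trans lV.
exists (last_z (B ^ l)); split; first exact: lastV.
pose S y := (vars H y (last_z y) (total y), h).
apply: (@exec_le _ _ _ _ _ 0 (\sum_(y < B ^ l) ((N y).+1 * inner_cost n l flag +
    for_cost 1 (pow_expr base l)) + for_cost 1 (pow_expr base l))) => //.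
  rewrite mulnDl mul1n big_distrl /= leq_add//; last by rewrite leq_addl.
  apply: leq_sum => y _; rewrite /outer_cost mulnDr leq_add2l leq_pmull//.
apply: (@exec_for 4 (bitlen V) 1 _ _ _ _ S (fun y => (N y).+1 * inner_cost n l flag)) => //.
- by rewrite vars_pow.
- exact: wf.
- by rewrite /set_var /= set_varsE//= /S /last_z /total big_ord0.
- by move=> y yB; apply: wf => //; [exact: leq_trans lV | exact: totV].
- by move=> y _; rewrite eval_pow eval_bE.
- move=> y yB.
  pose S' z := (vars H y z (total y + \sum_(i < z) F y i), h).
  have totV' z : z <= N y -> total y + \sum_(i < z) F y i <= V.
    move=> zN; apply: leq_trans BkV; rewrite VE.
    have h1 := FS y z (leq_trans zN (NB y)); have h2 := totalS y.
    have : y.+1 * (B ^ l * (B * B) ^ k) <= B ^ l * (B ^ l * (B * B) ^ k).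
      by rewrite leq_mul2r yB orbT.
    by rewrite mulSn; lia.
  have yV : y <= V by apply: leq_trans (ltnW yB) lV.
  have -> : set_var (S y.+1) 1 y = S' (N y).
    by rewrite /set_var /S /S' /= set_varsE//= /total big_ord_recr.
  apply: (@exec_for_const 4 (bitlen V) 2 _ _ _ _ S') => //.
  + by rewrite /= vf vars_pow.
  + by apply: wf => //; apply: totV; apply: ltnW.
  + by rewrite /set_var /S /S' /= set_varsE//= big_ord0 addn0.
  + move=> z zN; apply: wf => //; last exact: totV'.
    by apply: leq_trans lV; apply: leq_trans zN (NB y).
  + by move=> z zN; rewrite (eval_bin _ _ OMul) eval_pow eval_bE flE.
  + move=> z zN; have wz : well_formed 4 (bitlen V) (S' z).
      apply: wf => //; last by apply: totV'; apply: ltnW.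
      by apply: leq_trans lV; apply: leq_trans (ltnW zN) (NB y).
    have := @exec_assign 4 (bitlen V) 3 (Var 3 [+] match_expr n l) (S' z) isT (vars_match n l) wz.
    rewrite (eval_bin _ _ OAdd) eval_match /S' /= set_varsE//= /set_var /= set_varsE//=.
    by rewrite big_ord_recr /= addnA.
Qed.

(** * Pruning, padding and output *)

(** The gcd is only tabulated for a first argument at least as large as the second,
so the maximum and the minimum of r1 and r2 are formed by truncated subtraction. *)
Definition compatible_test r1 r2 :=
  let hi := r2 [+] (r1 [-] r2) in let lo := r1 [-] (r1 [-] r2) in
  let g := Fetch (gcd_cell (hi [*] base [+] lo)) in
  ne0_expr (r1 [*] r2) [*] le_expr (r1 [*] r2) (Var 0 [*] pow_expr g 2).

Definition compatible_expr :=
  compatible_test (digit_expr base 0 (Var 1)) (digit_expr base 1 (Var 1)).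

Lemma gcd_table_maxmin B r1 r2 : r1 < B -> r2 < B ->
  gcd_table B (B * B) ((r2 + (r1 - r2)) * B + (r1 - (r1 - r2))) = gcdn r1 r2.
Proof.
move=> r1B r2B; rewrite -maxnE -minnE.
have aB : maxn r2 r1 < B by rewrite gtn_max r2B.
have iB : minn r1 r2 < B by rewrite gtn_min r1B.
have ia : minn r1 r2 <= maxn r2 r1 by rewrite geq_min leq_max leqnn orbT.
have B0 : 0 < B by apply: leq_trans r1B.
rewrite /gcd_table divnMDl// modnMDl (divn_small iB) (modn_small iB) addn0 ia andbT.
have -> : maxn r2 r1 * B + minn r1 r2 < B * B.
  have : (maxn r2 r1).+1 * B <= B * B by rewrite leq_mul2r aB orbT.
  by rewrite mulSn; lia.
rewrite maxnC /maxn /minn; case: ltnP => //; by rewrite gcdnC.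
Qed.

Lemma eval_compatible_test H x y z c r1 r2 : let B := H.+1 in
  let ev := eval (vars H x y z) (layout (gcd_table B (B * B)) c) in
  ev r1 < B -> ev r2 < B -> ev (compatible_test r1 r2) = compatible H (ev r1) (ev r2).
Proof.
move=> B ev r1B r2B.
rewrite /compatible_test /ev (eval_bin _ _ OMul (ne0_expr _)) eval_ne0 eval_le.
rewrite (eval_bin _ _ OMul (Var 0)) eval_pow eval_gcd_cell -/ev.
rewrite -[X in gcd_table _ _ X]/((ev r2 + (ev r1 - ev r2)) * ev base +
  (ev r1 - (ev r1 - ev r2))).
by rewrite [ev base]eval_bE gcd_table_maxmin//= mulnb.
Qed.

Lemma eval_compatible H y z s c : let B := H.+1 in
  eval (vars H y z s) (layout (gcd_table B (B * B)) c) compatible_expr =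
  compatible H (digit B 0 y) (digit B 1 y).
Proof.
by move=> B; rewrite eval_compatible_test !eval_digit !eval_bE ?ltn_pmod.
Qed.

Definition pad_cmd e := Seq (Assign 1 (Const 0))
  (While (pow_expr (Var 0) e [-] Var 1 [*] Var 1) (Assign 1 (Var 1 [+] Const 1))).

Definition pad_cost e := assign_cost (Const 0) + assign_cost (Var 1 [+] Const 1) +
  while_cost (pow_expr (Var 0) e [-] Var 1 [*] Var 1).

(** The loop stops at the least i with H ^ e <= i ^ 2, which is K + 1; its length is
the lower bound for the running time. *)
Lemma exec_pad V H x y s h e K :
  (forall x, x <= V -> well_formed 4 (bitlen V) (vars H x y s, h)) -> x <= V ->
  K.+1 <= V -> K ^ 2 < H ^ e <= K.+1 ^ 2 ->
  exec 4 (bitlen V) (pad_cmd e) (vars H x y s, h) (vars H K.+1 y s, h) K.+1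
    (K.+2 * pad_cost e).
Proof.
move=> wf xV KV /andP[K1 K2].
apply: (@exec_le _ _ _ _ _ (0 + K.+1) (assign_cost (Const 0) +
  (\sum_(i < K.+1) (assign_cost (Var 1 [+] Const 1) +
     while_cost (pow_expr (Var 0) e [-] Var 1 [*] Var 1)) +
     while_cost (pow_expr (Var 0) e [-] Var 1 [*] Var 1)))) => //.
  rewrite sum_nat_const card_ord /pad_cost.
  move: (assign_cost _) (assign_cost _) (while_cost _) => a b c; nia.
pose S i := (vars H i y s, h).
apply: (exec_seq (s2 := S 0)).
  have := @exec_assign 4 (bitlen V) 1 (Const 0) _ isT isT (wf _ xV).
  by rewrite /= set_varsE.
apply: (@exec_while 4 _ _ _ _ S (fun=> assign_cost (Var 1 [+] Const 1))) => //.
- by rewrite /= vars_pow.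
- by move=> i iK; apply: wf; apply: leq_trans KV.
- move=> i iK; rewrite (eval_bin _ _ OSub) eval_pow /= -lt0n subn_gt0.
  by apply: leq_ltn_trans K1; rewrite mulnn leq_exp2r.
- by rewrite (eval_bin _ _ OSub) eval_pow /=; apply/eqP; rewrite subn_eq0 mulnn.
- move=> i iK; have := @exec_assign 4 (bitlen V) 1 (Var 1 [+] Const 1) (S i) isT isT
    (wf _ (leq_trans (ltnW iK) KV)).
  by rewrite /= set_varsE//= /vars /= addn1.
Qed.

Lemma exec_computes w c x s lo hi : exec 4 w c (vars x 0 0 0, fun=> 0) s lo hi ->
  exists t, [/\ lo <= t, t <= hi * w ^ 2 & computes_in (code 4 c 0) x (s.1 0) t].
Proof.
move=> [t [lt ht r]]; exists t; split=> //.
exists (layout s.1 s.2); last by rewrite -(layout_var s.1 s.2 0).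
have -> : input x = layout (vars x 0 0 0) (fun=> 0).
  apply: funext => -[|j]; first by [].
  rewrite /input /set_reg /layout /=; case: ifP => // /negbFE jo.
  by rewrite uphalf_half jo /vars; case: (j./2) => [|[|[|?]]] //=; rewrite nth_nil.
have oc : occurs (code 4 c 0) (code 4 c 0) 0 by exists [::], [::]; rewrite cats0.
(* After the last instruction the machine halts at no cost. *)
rewrite -[t]addn0; apply: (r _ _ oc); apply: runs_halt; exact: leqnn.
Qed.

Definition output_cmd n := Assign 0 (pow_expr (Var 3) n).

Definition tail_cmd n := Seq (pad_cmd (3 * n - 2)) (output_cmd n).

Definition tail_cost n := pad_cost (3 * n - 2) + assign_cost (pow_expr (Var 3) n).

Lemma exec_tail V H x y s h n K : let e := 3 * n - 2 in
  (forall x, x <= V -> well_formed 4 (bitlen V) (vars H x y s, h)) -> x <= V ->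
  K.+1 <= V -> K ^ 2 < H ^ e <= K.+1 ^ 2 ->
  exec 4 (bitlen V) (tail_cmd n) (vars H x y s, h) (vars (s ^ n) K.+1 y s, h) K.+1
    (K.+2 * tail_cost n).
Proof.
move=> e wf xV KV HK.
apply: (@exec_le _ _ _ _ _ (K.+1 + 0) (K.+2 * pad_cost e + assign_cost (pow_expr (Var 3) n))).
- by rewrite addn0.
- by rewrite /tail_cost mulnDr leq_add2l leq_pmull.
- apply: exec_seq (exec_pad wf xV KV HK) _.
  have := @exec_assign 4 (bitlen V) 0 (pow_expr (Var 3) n) _ isT
    (@vars_pow 4 (Var 3) n isT) (wf _ KV).
  by rewrite eval_pow /= set_varsE.
Qed.

(** * Correctness and number of iterations *)

(** Pruning is needed for n = 3 only, where l = 2 and the two entries of rs are all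
the denominators of the second half. *)
Definition admissible n H rs := if n == 3 then compatible H (nth 0 rs 0) (nth 0 rs 1) else true.
Definition admissible_expr n := if n == 3 then compatible_expr else Const 1.

Definition candidates n l H :=
  \sum_(y < H.+1 ^ l) admissible n H (digits H.+1 l y) * H.+1 ^ l.

Definition stochastic_cmd n :=
  let k := n./2 in let l := uphalf n in
  Seq gcd_cmd (Seq (count_cmd n k) (Seq (match_cmd n l (admissible_expr n)) (tail_cmd n))).

Lemma isqrt_gt0_ex m : 0 < m -> exists K, K ^ 2 < m <= K.+1 ^ 2.
Proof.
by case: m => // m _; have [K /andP[K1 K2]] := isqrt_ex m; exists K; rewrite ltnS K1.
Qed.

Lemma root_le_bound n H K : 0 < n -> K ^ 2 < H ^ (3 * n - 2) -> K.+1 <= (H.+1 * H.+1) ^ n.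
Proof.
move=> n0 K1; rewrite -(@ltn_exp2r _ _ 2)//; apply: leq_trans K1 _.
rewrite -expnM mulnn -expnM; apply: (@leq_trans (H.+1 ^ (3 * n - 2))).
  by case: (posnP (3 * n - 2)) => [->|p0] //; rewrite leq_exp2r.
by rewrite leq_pexp2l//; lia.
Qed.

Lemma match_total n H : 0 < n -> let B := H.+1 in let l := uphalf n in let k := n./2 in
  \sum_(y < B ^ l) \sum_(z < admissible n H (digits B l y) * B ^ l)
       match_count B n k (pair_digits B l y z) = word_sum (B * B) n (stochastic_row B).
Proof.
move=> n0 B l k; have lk : l + k = n by rewrite /l uphalf_half -addnA addnn odd_double_half.
rewrite -[in RHS]lk -(@meet_in_the_middle B n k l (admissible n H))//; try lia.
move=> qs qs' sqs sqs' lqs; rewrite /admissible; case: eqP => // n3.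
move: sqs sqs' lqs; rewrite /l /k n3 /=.
case: qs => [|q1 [|q2 [|]]] //; case: qs' => [|q3 [|]] // _ _ /=.
rewrite andbT => /and3P[l1 l2 l3] /andP[/= /and4P[v1 v2 v3 _] /eqP e].
by apply: (compatible_of_sum3 v1 v2 v3 _ e); rewrite -ltnS ltn_divLR.
Qed.

Definition phase_cost n := gcd_cost + count_cost n n./2 +
  outer_cost n (uphalf n) (admissible_expr n) + tail_cost n.

(** Every number in sight is at most V = B ^ (2n): there are no more than that many
tuples, so this bounds all counters and counts. *)
Lemma exec_stochastic n H K : 1 < n -> 0 < H -> K ^ 2 < H ^ (3 * n - 2) <= K.+1 ^ 2 ->
  let B := H.+1 in let l := uphalf n in let k := n./2 in
  exists s, s.1 0 = word_sum (B * B) n (stochastic_row B) ^ n /\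
    exec 4 (bitlen ((B * B) ^ n)) (stochastic_cmd n) (vars H 0 0 0, fun=> 0) s K.+1
     ((B * B + (B * B) ^ k + B ^ l + candidates n l H + K + 2) * phase_cost n).
Proof.
move=> n1 H0 HK B l k; have B0 : 0 < B by []; set V := (B * B) ^ n.
have n0 : 0 < n by apply: ltnW.
have B1 : 0 < B * B by [].
have BV : B * B <= V by rewrite -[leqLHS]expn1 leq_pexp2l.
have lk : l + k = n by rewrite /l uphalf_half -addnA addnn odd_double_half.
have kV : (B * B) ^ k <= V by rewrite leq_pexp2l//; lia.
pose fl := admissible n H.
have vf : vars_below 4 (admissible_expr n) by rewrite /admissible_expr; case: ifP.
have flE y z s : y < B ^ l -> eval (vars H y z s)
    (layout (gcd_table B (B * B)) (count_table B n k ((B * B) ^ k))) (admissible_expr n) =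
    fl (digits B l y).
  move=> _; rewrite /admissible_expr /fl /admissible /l; case: eqP => // ->.
  by rewrite eval_compatible.
have [||z [zV ex]] := exec_match (V := V) (n := n) vf flE => //; first by rewrite lk.
have rc : \sum_(y < B ^ l) \sum_(z < fl (digits B l y) * B ^ l)
    match_count B n k (pair_digits B l y z) = word_sum (B * B) n (stochastic_row B).
  exact: match_total.
rewrite rc in ex.
have tV : word_sum (B * B) n (stochastic_row B) <= V.
  by rewrite -[leqRHS]muln1; apply: leq_word_sum => s; exact: leq_b1.
have HV : H <= V by rewrite (leq_trans _ BV)// /B; lia.
have lV : B ^ l <= V.
  by rewrite /V mulnn -expnM leq_pexp2l//; lia.
set h := layout _ _ in ex.
have wf x : x <= V -> well_formed 4 (bitlen V)
    (vars H x z (word_sum (B * B) n (stochastic_row B)), h).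
  move=> xV; apply: well_formed_vars => //.
    move=> q; rewrite (leq_trans (gcd_table_le _ B0 (leqnn _)))// (leq_trans _ BV)// leq_pmull//.
  by move=> q; exact: leq_trans (count_table_le _ _ _ _ _) kV.
have KV : K.+1 <= V by apply: root_le_bound => //; case/andP: HK.
have := exec_seq (exec_gcd BV) (exec_seq (exec_count n BV kV)
  (exec_seq ex (exec_tail (n := n) wf lV KV HK))).
rewrite !add0n; set s := (vars _ _ _ _, h) => {}ex.
exists s; split; first by [].
apply: (exec_le _ _ ex); first exact: leqnn.
rewrite /phase_cost.
have -> : \sum_(y < B ^ l) (fl (digits B l y) * B ^ l).+1 = candidates n l H + B ^ l.
  rewrite /candidates -[X in _ + X]card_ord -sum1_card -big_split /=.
  by apply: eq_bigr => y _; rewrite addn1.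
move: gcd_cost (count_cost n _) (outer_cost _ _ _) (tail_cost n) => a b c d.
set x := B * B; set y := x ^ k; set u := B ^ l; set v := candidates n l H.
rewrite -/x -/y -/u -/v; set S := x + y + u + v + K + 2.
have le m e : m <= S -> m * e <= S * e by rewrite leq_mul2r => ->; rewrite orbT.
rewrite !(mulnDr S) -!(addnA (S * a)) -!(addnA (S * b)).
by apply: leq_add; [|apply: leq_add; [|apply: leq_add]]; apply: le; rewrite /S; lia.
Qed.

(** For n = 3 this is [count_compatible] times the square of the number of pairs of
numerators; otherwise all B ^ (2l) pairs are tried and 4l <= 3n - 2. *)
Lemma candidates_sqr n H : 1 < n -> 0 < H ->
  (candidates n (uphalf n) H) ^ 2 <= 4 ^ (n + n) * bitlen H ^ 4 * H ^ (3 * n - 2).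
Proof.
move=> n1 H0; have BH : H.+1 <= 2 * H by lia.
have powB m : 2 * m <= 3 * n - 2 -> H.+1 ^ (2 * m) <= 2 ^ (2 * m) * H ^ (3 * n - 2).
  move=> hm; apply: (@leq_trans ((2 * H) ^ (2 * m))).
    by case: m {hm} => // m; rewrite leq_exp2r// mulnS.
  by rewrite expnMn leq_mul2l leq_pexp2l ?orbT.
have L0 : 0 < bitlen H ^ 4 by rewrite expn_gt0.
rewrite /candidates /admissible; case: eqP => [->|n3].
  rewrite -big_distrl /= -[\sum_(_ < _) _](_ :
    \sum_(r1 < H.+1) \sum_(r2 < H.+1) compatible H r1 r2 = _).
    rewrite expnMn; apply: leq_trans (leq_mul (count_compatible H) (leqnn _)) _.
    rewrite -expnM (_ : 3 * 3 - 2 = 3 + 4)// (expnD H 3 4).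
    have : H.+1 ^ (2 * 2) <= 2 ^ 4 * H ^ 4.
      by rewrite -expnMn leq_exp2r.
    move: (H.+1 ^ _) (bitlen H ^ 4) (H ^ 3) (H ^ 4) => a b c d h.
    have -> : 4 ^ (3 + 3) = 2 ^ 4 * 256 by [].
    have : c * b * a <= c * b * (2 ^ 4 * d) by rewrite leq_mul2l h orbT.
    by move/leq_trans; apply; rewrite (_ : 2 ^ 4 = 16)//; nia.
  rewrite expnS expn1 (sum_mul _ _ (fun y => nat_of_bool
    (compatible H (nth 0 (digits H.+1 2 y) 0) (nth 0 (digits H.+1 2 y) 1)))).
  rewrite exchange_big; apply: eq_bigr => r1 _; apply: eq_bigr => r2 _.
  by rewrite digitsS//= /digit expn0 divn1 modn_small.
rewrite sum_nat_const card_ord mul1n -expnD -expnM mulnC.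
rewrite (leq_trans (powB _ _))//; first by rewrite uphalf_half; lia.
rewrite leq_mul2r; apply/orP; right; rewrite -[leqLHS]muln1 leq_mul//.
by rewrite expnM leq_pexp2l// leq_add// uphalf_half; lia.
Qed.

(** * Bounds for the running time *)

Lemma bitlen_pow H n : 0 < H -> bitlen ((H.+1 * H.+1) ^ n) <= (4 * n).+1 * bitlen H.
Proof.
move=> H0; have L0 : 0 < bitlen H by [].
rewrite bitlen_le ?muln_gt0//.
have HL : H < 2 ^ bitlen H by exact: ltn_bitlen.
apply: (@leq_ltn_trans ((2 ^ bitlen H * 2 ^ bitlen H) ^ n)).
  by case: n => // n; rewrite leq_exp2r// leq_mul.
rewrite -expnD -expnM ltn_exp2l//.
by move: (bitlen H) L0 => L L0; nia.
Qed.

Lemma leq_sqrt_of_sqr X a b : X ^ 2 <= b < X.+1 ^ 2 -> a ^ 2 <= b -> a <= X.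
Proof.
by move=> /andP[_ bX] ab; rewrite -ltnS -(@ltn_exp2r _ _ 2)//; apply: leq_ltn_trans bX.
Qed.

(** Every phase has at most X iterations, X being the square root of
4 ^ (2n) L ^ 4 H ^ (3n-2), rounded down; the word length contributes L ^ 2 to the time and so
L ^ 4 to its square. *)
Lemma run_stochastic n : 1 < n -> exists C, forall H, 0 < H ->
  exists t, [/\ computes_in (code 4 (stochastic_cmd n) 0) H
     (word_sum (H.+1 * H.+1) n (stochastic_row H.+1) ^ n) t,
    H ^ (3 * n - 2) <= t ^ 2 & t ^ 2 <= C * bitlen H ^ 8 * H ^ (3 * n - 2)].
Proof.
move=> n1.
have [k_n k_exp] : 2 * n./2 <= n /\ 2 * (2 * n./2) <= 3 * n - 2.
  by have := odd_double_half n; lia.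
have [l_n l_exp] : uphalf n <= n /\ 2 * uphalf n <= 3 * n - 2.
  by rewrite uphalf_half; have := odd_double_half n; lia.
have exp4 : 2 * 2 <= 3 * n - 2 by lia.
exists ((7 * phase_cost n * (4 * n).+1 ^ 2) ^ 2 * 4 ^ (n + n)) => H H0.
have [K HK] : exists K, K ^ 2 < H ^ (3 * n - 2) <= K.+1 ^ 2.
  by apply: isqrt_gt0_ex; rewrite expn_gt0 H0.
have [s [s0 ex]] := exec_stochastic n1 H0 HK.
have [t [lt ht ct]] := exec_computes ex.
exists t; split; first by rewrite -s0.
  by case/andP: HK => _ K2; apply: leq_trans K2 _; rewrite leq_exp2r.
set M := 4 ^ (n + n) * bitlen H ^ 4 * H ^ (3 * n - 2).
have [X HX] := isqrt_ex M.
have L0 : 0 < bitlen H ^ 4 by rewrite expn_gt0.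
have powB m : m <= n -> 2 * m <= 3 * n - 2 -> H.+1 ^ m <= X.
  move=> mn hm; apply: (leq_sqrt_of_sqr HX).
  apply: (@leq_trans ((2 * H) ^ (m * 2))).
    by rewrite -expnM; case: m {mn hm} => // m; rewrite leq_exp2r ?mulSn//; lia.
  rewrite expnMn; apply: leq_mul.
    apply: (@leq_trans (4 ^ (n + n))); last by rewrite leq_pmulr.
    by rewrite mulnC expnM leq_pexp2l// (leq_trans mn)// leq_addr.
  by rewrite leq_pexp2l// mulnC.
have XB1 : 1 <= X by exact: (powB 0).
have XB : H.+1 * H.+1 <= X by rewrite mulnn powB.
have Xk : (H.+1 * H.+1) ^ n./2 <= X.
  by rewrite mulnn -expnM; apply: powB.
have Xl : H.+1 ^ uphalf n <= X.
  exact: powB.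
have Xc : candidates n (uphalf n) H <= X by apply: (leq_sqrt_of_sqr HX); apply: candidates_sqr.
have XK : K <= X.
  apply: (leq_sqrt_of_sqr HX); case/andP: HK => /ltnW K1 _; apply: leq_trans K1 _.
  by rewrite leq_pmull// muln_gt0 expn_gt0.
set c := phase_cost n in ht *.
set P := (_ + _ + _) in ht.
have PX : P <= 7 * X.
  rewrite /P; move: XB1 XB Xk Xl Xc XK.
  move: (_ * _) (_ ^ _) (_ ^ _) (candidates _ _ _) => a b d e; clear; lia.
have wL := bitlen_pow n H0; set w := bitlen _ in ht wL.
have tX : t <= 7 * c * (4 * n).+1 ^ 2 * bitlen H ^ 2 * X.
  apply: leq_trans ht _; apply: (@leq_trans (7 * X * c * ((4 * n).+1 * bitlen H) ^ 2)).
    by rewrite leq_mul ?leq_exp2r// leq_mul2r PX orbT.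
  rewrite expnMn; move: (_ ^ 2) (_ ^ 2) => a b.
  by rewrite leq_eqVlt; apply/orP; left; apply/eqP; clear; lia.
apply: (@leq_trans ((7 * c * (4 * n).+1 ^ 2 * bitlen H ^ 2 * X) ^ 2)); first by rewrite leq_exp2r.
rewrite [leqLHS]expnMn (expnMn _ (bitlen H ^ 2)) -expnM.
have X2 : X ^ 2 <= M by case/andP: HX.
apply: leq_trans (leq_mul (leqnn _) X2) _.
rewrite /M (_ : bitlen H ^ 8 = bitlen H ^ 4 * bitlen H ^ 4); last by rewrite -expnD.
move: (_ ^ 2) (4 ^ _) (_ ^ 4) (H ^ _) => a b d e.
by rewrite leq_eqVlt; apply/orP; left; apply/eqP; clear; lia.
Qed.

Definition trivial_cmd := Seq (Assign 3 (Const 1)) (tail_cmd 1).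

Lemma run_trivial : exists C, forall H, 0 < H ->
  exists t, [/\ computes_in (code 4 trivial_cmd 0) H 1 t,
    H <= t ^ 2 & t ^ 2 <= C * bitlen H ^ 8 * H].
Proof.
pose c := assign_cost (Const 1) + tail_cost 1.
exists ((4 * c * 5 ^ 2) ^ 2) => H H0.
have [K HK] := isqrt_gt0_ex H0; set V := (H.+1 * H.+1) ^ 1.
have VE : V = H.+1 * H.+1 by rewrite /V expn1.
have wf x s : x <= V -> s <= 1 -> well_formed 4 (bitlen V) (vars H x 0 s, fun=> 0).
  move=> xV s1; have -> : (fun=> 0) = layout (fun=> 0) (fun=> 0).
    by apply: funext => j; rewrite /layout; case: ifP.
  by apply: well_formed_vars => //; split=> //; rewrite VE; lia.
have KV : K.+1 <= V.
  by case/andP: HK => K1 _; rewrite VE; move: K1; rewrite -mulnn; nia.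
have := @exec_assign 4 (bitlen V) 3 (Const 1) (vars H 0 0 0, fun=> 0) isT isT (wf 0 0 isT isT).
rewrite /= set_varsE//= => ex1.
have HK' : K ^ 2 < H ^ (3 * 1 - 2) <= K.+1 ^ 2 by rewrite expn1.
have := exec_seq ex1 (exec_tail (n := 1) (fun x xV => wf x 1 xV isT) (leq0n V) KV HK').
move=> /exec_computes[t [lt ht ct]]; exists t; split; first by [].
  by case/andP: HK => _ K2; apply: leq_trans K2 _; rewrite leq_exp2r.
have wL := bitlen_pow 1 H0; rewrite -/V in wL; set w := bitlen V in ht wL.
have K1H : K.+1 ^ 2 <= 4 * H.
  by case/andP: HK => K1 _; apply: (@leq_trans (4 * (K ^ 2).+1)); [rewrite -!mulnn; nia|lia].
have tX : t <= 2 * c * 5 ^ 2 * bitlen H ^ 2 * K.+1.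
  apply: leq_trans ht _; apply: (@leq_trans (2 * K.+1 * c * (5 * bitlen H) ^ 2)).
    rewrite leq_mul ?leq_exp2r// /c.
    by move: (assign_cost _) (tail_cost _) => a b; clear; nia.
  rewrite expnMn; move: (_ ^ 2) (_ ^ 2) => a b.
  by rewrite leq_eqVlt; apply/orP; left; apply/eqP; clear; lia.
apply: (@leq_trans ((2 * c * 5 ^ 2 * bitlen H ^ 2 * K.+1) ^ 2)); first by rewrite leq_exp2r.
rewrite [leqLHS]expnMn (expnMn _ (bitlen H ^ 2)) -expnM.
apply: leq_trans (leq_mul (leqnn _) K1H) _.
have L48 : bitlen H ^ (2 * 2) <= bitlen H ^ 8 by rewrite leq_pexp2l.
rewrite (_ : 4 * c = 2 * (2 * c)); last by rewrite mulnA.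
rewrite -[2 * (2 * c) * _]mulnA (expnMn 2 (2 * c * _)).
move: (_ ^ 2) (_ ^ 8) (_ ^ (2 * 2)) L48 => a b d L48.
have : a * d <= a * b by rewrite leq_mul2l L48 orbT.
rewrite (_ : 2 ^ 2 = 4)//; clear; nia.
Qed.

(** * The exponent of the running time *)

Section Exponent.
Variable R : realType.
Local Open Scope ring_scope.
Local Open Scope classical_set_scope.

Definition sqrt_ln (H : nat) : R := Num.sqrt (ln H%:R).

Lemma sqrt_ln_cvg : sqrt_ln H @[H --> \oo] --> +oo.
Proof.
apply/cvgryPge => A; near=> H.
have HA : expR (A ^+ 2) <= H%:R by near: H; exact: nbhs_infty_ger.
have H0 : 0 < H%:R :> R by apply: lt_le_trans HA; exact: expR_gt0.
apply: (le_trans (ler_norm A)); rewrite -sqrtr_sqr; apply: ler_wsqrtr.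
by rewrite -[leLHS]expRK ler_ln// posrE expR_gt0.
Unshelve. all: by end_near. Qed.

Lemma bitlen_le_ln H : (2 <= H)%N -> (bitlen H)%:R * ln 2 <= 2 * ln H%:R :> R.
Proof.
move=> H2; have H0 : 0 < H%:R :> R by rewrite ltr0n; apply: leq_trans H2.
have l2 : ln 2 <= ln H%:R :> R by rewrite ler_ln ?posrE// ler_nat.
have : (trunc_log 2 H)%:R * ln 2 <= ln H%:R :> R.
  rewrite mulr_natl -lnXn// -natrX ler_ln ?posrE// ?ler_nat ?ltr0n ?expn_gt0//.
  by apply: trunc_logP => //; apply: leq_trans H2.
by rewrite /bitlen -addn1 natrD mulrDl mul1r; lra.
Qed.

(** The exponent of T is ln T / ln H, and the bounds give
0 <= 2 ln T - (3n-2) ln H <= ln C + 8 ln L.  As L is of order ln H, and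
ln y <= y for y = sqrt (ln H), the right-hand side is of order y, which is small
against ln H = y^2. *)
Lemma exponent_cvg (T : nat -> nat) (C n : nat) : (0 < n)%N ->
  (forall H, (0 < H)%N -> (H ^ (3 * n - 2) <= T H ^ 2 <= C * bitlen H ^ 8 * H ^ (3 * n - 2))%N) ->
  exists e : nat -> R, e H @[H --> \oo] --> (0 : R) /\
    \forall H \near \oo, (T H)%:R = (H%:R : R) `^ (3 * n%:R / 2 - 1 + e H).
Proof.
move=> n0 TH.
pose e H : R := ln (T H)%:R / ln H%:R - (3 * n%:R / 2 - 1).
have mE : (3 * n - 2)%:R = 2 * (3 * n%:R / 2 - 1) :> R.
  rewrite natrB ?natrM; last by lia.
  by field.
have T0 H : (0 < H)%N -> (0 < T H)%N.
  move=> H0; have /andP[+ _] := TH H H0; case: (T H) => //.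
  by rewrite leqNgt expn_gt0 H0.
(* C + 1 is positive, and 2 / ln 2 is the constant in L <= (2 / ln 2) ln H. *)
pose A : R := ln C.+1%:R + 8 * ln (2 / ln 2).
have l2 : 0 < ln 2 :> R by rewrite ln_gt0// ltr1n.
have l2' : ln 2 < 2 :> R by exact: ln_sublinear.
have key H : (3 <= H)%N -> 1 <= ln H%:R :> R ->
    0 <= e H <= (A + 16) / 2 * (sqrt_ln H)^-1.
  move=> H3 H1; have H0 : (0 < H)%N by apply: leq_trans H3.
  have HR0 : 0 < H%:R :> R by rewrite ltr0n.
  have TR0 : 0 < (T H)%:R :> R by rewrite ltr0n T0.
  have L0 : 0 < (bitlen H)%:R :> R by rewrite ltr0n.
  have /andP[lo hi] := TH H H0.
  have lo' : (3 * n - 2)%:R * ln H%:R <= 2 * ln (T H)%:R :> R.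
    rewrite !mulr_natl -!lnXn// -!natrX ler_ln ?posrE ?ltr0n ?expn_gt0 ?H0 ?T0// ler_nat.
    exact: lo.
  have hi' : 2 * ln (T H)%:R <= ln C.+1%:R + 8 * ln (bitlen H)%:R + (3 * n - 2)%:R * ln H%:R :> R.
    have -> : ln C.+1%:R + 8 * ln (bitlen H)%:R + (3 * n - 2)%:R * ln H%:R =
        ln (C.+1%:R * (bitlen H)%:R ^+ 8 * H%:R ^+ (3 * n - 2)) :> R.
      by rewrite !lnM ?lnXn ?posrE ?mulr_gt0 ?exprn_gt0 ?ltr0n// !mulr_natl.
    rewrite mulr_natl -lnXn// -!natrX -!natrM.
    rewrite ler_ln ?posrE ?ltr0n ?muln_gt0 ?expn_gt0 ?H0 ?T0// ler_nat.
    apply: leq_trans hi _; rewrite leq_mul2r; apply/orP; right; rewrite leq_mul2r leqnSn orbT//.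
  set y := sqrt_ln H; have y2 : y ^+ 2 = ln H%:R by rewrite sqr_sqrtr// (le_trans _ H1).
  have y1 : 1 <= y by rewrite -[leLHS]sqrtr1 ler_wsqrtr.
  have y0 : 0 < y by apply: lt_le_trans y1.
  have Lb : ln (bitlen H)%:R <= ln (2 / ln 2) + 2 * y.
    apply: (@le_trans _ _ (ln (2 / ln 2 * y ^+ 2))).
      rewrite ler_ln ?posrE ?mulr_gt0 ?invr_gt0 ?exprn_gt0//.
      rewrite mulrAC ler_pdivlMr// y2; apply: bitlen_le_ln; exact: ltnW.
    rewrite lnM ?posrE ?mulr_gt0 ?invr_gt0 ?exprn_gt0// lnXn// lerD2l.
    rewrite -[ln y *+ 2]mulr_natl ler_pM2l//.
    by apply/ltW/ln_sublinear.
  have eE : e H = (2 * ln (T H)%:R - (3 * n - 2)%:R * ln H%:R) / (2 * y ^+ 2).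
    rewrite /e mE y2; field; apply/eqP; lra.
  have A0 : 0 <= A.
    rewrite addr_ge0 ?mulr_ge0 ?ln_ge0 ?ler1n//.
    by rewrite ler_pdivlMr// mul1r ltW.
  rewrite eE; apply/andP; split.
    by rewrite divr_ge0 ?subr_ge0// mulr_ge0// sqr_ge0.
  rewrite ler_pdivrMr ?mulr_gt0 ?exprn_gt0//.
  have -> : (A + 16) / 2 / y * (2 * y ^+ 2) = (A + 16) * y by field; rewrite gt_eqF.
  have : A <= A * y by rewrite ler_peMr.
  by rewrite mulrDl /A; lra.
exists e; split.
  apply: (@squeeze_cvgr _ _ _ _ (cst 0) (fun H => (A + 16) / 2 * (sqrt_ln H)^-1)).
  - near=> H; apply: key; first by near: H; exact: nbhs_infty_ge.
    have HA : expR 1 <= H%:R :> R by near: H; exact: nbhs_infty_ger.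
    by rewrite -[leLHS]expRK ler_ln// posrE ?expR_gt0// (lt_le_trans (expR_gt0 1)).
  - exact: cvg_cst.
  - rewrite -(mulr0 ((A + 16) / 2)); apply: cvgM; first exact: cvg_cst.
    apply/gtr0_cvgV0; last exact: sqrt_ln_cvg.
    near=> H; rewrite sqrtr_gt0 ln_gt0// ltr1n.
    by near: H; exact: nbhs_infty_ge.
near=> H.
have H2 : (1 < H)%N by near: H; exact: nbhs_infty_ge.
have HR0 : 0 < H%:R :> R by rewrite ltr0n ltnW.
have lH : 0 < ln H%:R :> R by rewrite ln_gt0// ltr1n.
rewrite /e addrC subrK /powR gt_eqF// divfK ?gt_eqF// lnK// posrE ltr0n T0//.
exact: ltnW.
Unshelve. all: by end_near. Qed.
End Exponent.

(** * The algorithm *)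

(** The only row of length 1 is the fraction 1/1. *)
Lemma word_sum_row1 H : 0 < H -> word_sum (H.+1 * H.+1) 1 (stochastic_row H.+1) = 1.
Proof.
move=> H0; set B := H.+1; have B1 : 1 < B by [].
have lt : B + 1 < B * B by nia.
have rowE q : stochastic_row B [:: q] = (q == B + 1).
  rewrite /stochastic_row /= andbT big_seq1 /reduced_code /code_val.
  apply/idP/eqP => [/andP[/andP[_ c] /eqP e]|->].
    have r0 : ((q %/ B)%:R != 0 :> rat)%R.
      by apply: contra_eq_neq e => ->; rewrite invr0 mulr0 eq_sym oner_neq0.
    move/(congr1 (fun x => x * (q %/ B)%:R)%R): e; rewrite divfK// mul1r.
    move/eqP; rewrite eqr_nat => /eqP e.
    move: c; rewrite e /coprime gcdnn => /eqP r1.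
    by rewrite (divn_eq q B) e r1 mul1n.
  have -> : (B + 1) %/ B = 1 by rewrite -{1}[B]mul1n divnMDl ?divn_small// ltnW.
  have -> : (B + 1) %% B = 1 by rewrite addnC modnDr modn_small.
  by rewrite divr1 eqxx.
rewrite /= (bigD1 (Ordinal lt))//= rowE eqxx big1// => d /eqP d1.
by rewrite rowE; case: eqP => // e; case: d1; apply: val_inj.
Qed.

(** For n = 1 even one pass over the fractions would exceed the time H^(1/2), so the
answer 1 is written down directly. *)
Lemma run_num_stochastic n : 0 < n -> exists p C, forall H, 0 < H ->
  exists t, [/\ computes_in p H (num_stochastic n H) t, H ^ (3 * n - 2) <= t ^ 2 &
    t ^ 2 <= C * bitlen H ^ 8 * H ^ (3 * n - 2)].
Proof.
case: n => [//|[|n]] _.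
  have [C run] := run_trivial; exists (code 4 trivial_cmd 0), C => H H0.
  rewrite num_stochasticE -word_sum_card word_sum_row1//.
  by have := run H H0; rewrite expn1.
have [C run] := run_stochastic (isT : 1 < n.+2).
exists (code 4 (stochastic_cmd n.+2) 0), C => H H0.
by rewrite num_stochasticE -word_sum_card; apply: run.
Qed.

Unset Implicit Arguments.
Local Open Scope classical_set_scope.
Local Open Scope ring_scope.

Theorem theorem3 (R : realType) (n : nat) (n_gt0 : (0 < n)%N) :
  exists (p : program) (T : nat -> nat),
    (forall H : nat, (0 < H)%N -> computes_in p H (num_stochastic n H) (T H)) /\
    exists e : nat -> R,
      e H @[H --> \oo] --> (0 : R) /\
      \forall H \near \oo,
        (T H)%:R = (H%:R : R) `^ (3 * n%:R / 2 - 1 + e H).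
Proof.
have [p [C run]] := run_num_stochastic n_gt0.
have /choice[T TP] : forall H, exists t, (0 < H)%N ->
    [/\ computes_in p H (num_stochastic n H) t, (H ^ (3 * n - 2) <= t ^ 2)%N &
      (t ^ 2 <= C * bitlen H ^ 8 * H ^ (3 * n - 2))%N].
  by case=> [|H]; [exists 0%N | have [t tP] := run H.+1 isT; exists t].
exists p, T; split=> [H H0|]; first by case: (TP H H0).
apply: (@exponent_cvg R T C n n_gt0) => H H0.
by case: (TP H H0) => _ -> ->.
Qed.
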